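(* In the setting of the context, assume $\hat{\mathcal{L}}^{rev}$ has a positive spectral gap and, for $p\in\mathbb{R}^d$, define $R(p):=\max_{x\in\mathcal{X}}\sum_{y\ne x}Q_{x,y}(p)$. Then $$t_{rel}(\hat{\mathcal{L}})\ \ge\ \frac{1}{2\sqrt2}\sqrt{t_{rel}\big(\mathbb{E}_\rho[R(p)Q^{rev}(p)]\big)}.$$ In particular, for $Q$ of the factorized form described in the context with $H_{x,y}(p)=\max(0,-\langle\sigma_{x,y},\nabla\log\rho(p)\rangle)$ and $\|\sigma_{x,y}\|=1$ (for $\bar Q_{x,y}>0$), defining $\bar R:=\max_{x\in\mathcal{X}}\sum_{y\ne x}\bar Q_{x,y}$, we have $$t_{rel}(\hat{\mathcal{L}})\ \ge\ \frac{1}{2\sqrt{2\bar R\,\mathbb{E}_\rho[\|\nabla\log\rho(p)\|^2]}}\sqrt{t_{rel}(\bar Q)}.$$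
   Context: $\mathcal{X}$ is a finite set, $d\ge1$, $\pi\in\mathcal{P}(\mathcal{X})$, $\rho\in\mathcal{P}(\mathbb{R}^d)$, $\hat\pi=\pi\otimes\rho$. For each $p\in\mathbb{R}^d$, $Q(p)\in\mathbb{R}^{\mathcal{X}\times\mathcal{X}}$ satisfies $Q_{x,y}(p)\ge0$ for $x\neq y$, $Q_{x,x}(p)=-\sum_{y\ne x}Q_{x,y}(p)$, and $Q_{x,y}(p)=0$ when $\{x,y\}\not\subset\mathrm{supp}(\pi)$; $\mu:\mathcal{X}\times\mathbb{R}^d\to\mathbb{R}^d$; all components of $Q$ and $\mu$ are in $L^2(\rho)$ as functions of $p$. $\mathcal{L}^D_p$ is the generator of a $\rho$-reversible Markov semigroup on $\mathbb{R}^d$, $\hat{\mathcal{L}}^D_p=\mathrm{Id}\otimes\mathcal{L}^D_p$, $\gamma\ge0$. The operator $$\hat{\mathcal{L}}f(x,p)=\sum_{y}Q_{x,y}(p)f(y,p)+\langle\mu_x(p),\nabla_pf(x,p)\rangle+\gamma\hat{\mathcal{L}}^D_pf(x,p)$$ is the generator of a (uniquely existing) Markov process $(Z_t)_{t\ge0}$ on $\mathcal{X}\times\mathbb{R}^d$, has domain $\hat{\mathcal{D}}\subset L^2(\hat\pi)$, and $C_c^\infty(\mathcal{X}\times\mathbb{R}^d)$ (functions with $f(x,\cdot)$ smooth compactly supported for each $x$) is a core for it. Put $q_x(p)=\sum_{y}Q_{y,x}(p)\pi_y/\pi_x$ for $x\in\mathrm{supp}(\pi)$ and $q_x(p)=0$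 otherwise. It is assumed that $(Z_t)$ is $\hat\pi$-invariant, i.e. for $\pi$-a.e. $x$, $\int\langle\nabla_pf,\mu_x\rangle\,\mathrm{d}\rho=-\int fq_x\,\mathrm{d}\rho$ for all $f\in C_c^\infty(\mathbb{R}^d)$. Reversible part: $Q^\dagger(p)=\mathrm{diag}(1/\pi)Q(p)^\top\mathrm{diag}(\pi)-\mathrm{diag}(q(p))$ (entries $Q_{y,x}(p)\pi_y/\pi_x$ read as $0$ if $\pi_x=0$), $Q^{rev}(p)=\frac12(Q(p)+Q^\dagger(p))$, and $\hat{\mathcal{L}}^{rev}f(x,p)=\sum_yQ^{rev}_{x,y}(p)f(y,p)+\gamma\hat{\mathcal{L}}^D_pf(x,p)$ for $f\in C_c^\infty(\mathcal{X}\times\mathbb{R}^d)$. Standing assumption: $\hat{\mathcal{L}}^{rev}$, with domain $\hat{\mathcal{D}}^{rev}\subset L^2(\hat\pi)$, is the self-adjoint operator associated to a closed symmetric Dirichlet form, and $C_c^\infty(\mathcal{X}\times\mathbb{R}^d)$ is a core for it; in particular $\hat{\mathcal{D}}\subset\hat{\mathcal{D}}^{rev}$ and $\langle f,\hat{\mathcal{L}}f\rangle_{L^2(\hat\pi)}=\langle f,\hat{\mathcal{L}}^{rev}f\rangle_{L^2(\hat\pi)}$ for $f\in\hat{\mathcal{D}}$. Spectral gap: $\mathrm{Gap}(\hat{\mathcal{L}}^{rev})=\inf\{-\langle\hat{\mathcal{L}}^{rev}f,f\rangle_{L^2(\hat\pi)}/\|f\|^2_{L^2(\hat\pi)}:f\in\hat{\mathcal{D}}^{rev}\setminus\{0\},\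 \mathbb{E}_{\hat\pi}f=0\}$. Relaxation time: for the generator $\mathcal{A}$ of a Markov process with invariant law $\nu$ and semigroup $(e^{t\mathcal{A}})_{t\ge0}$, $t_{rel}(\mathcal{A}):=\inf\{t\ge0:\|e^{t\mathcal{A}}f\|_{L^2(\nu)}\le e^{-1}\|f\|_{L^2(\nu)}\text{ for all }f\in L^2_0(\nu)\}$, where $L^2_0(\nu)$ is the space of mean-zero functions in $L^2(\nu)$. Here $\nu=\hat\pi$ for $\hat{\mathcal{L}}$, and $\nu=\pi$ for the generators $\mathbb{E}_\rho[R(p)Q^{rev}(p)]=\int R(p)Q^{rev}(p)\,\mathrm{d}\rho(p)$ and $\bar Q$ on $\mathcal{X}$. Factorized form: $\bar Q$ is a $\pi$-reversible generator on $\mathcal{X}$ ($\pi_x\bar Q_{x,y}=\pi_y\bar Q_{y,x}$), with $\bar Q_{x,y}=0$ if $\{x,y\}\not\subset\mathrm{supp}(\pi)$; $\rho$ has a positive density with $\nabla\log\rho:=\rho^{-1}\nabla\rho\in L^2(\rho)$; for $x\ne y$, $Q_{x,y}(p)=\bar Q_{x,y}H_{x,y}(p)$ if $\bar Q_{x,y}>0$ and $0$ otherwise; $\sigma_{x,y}\in\mathbb{R}^d$ with $\sigma_{x,y}=-\sigma_{y,x}$ for $\bar Q_{x,y}>0$. *)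

(* Defs.v *)
From HB Require Import structures.
From mathcomp Require Import all_boot all_order all_algebra.
From mathcomp Require Import all_classical all_reals all_analysis.

Set Implicit Arguments.
Unset Strict Implicit.
Unset Printing Implicit Defensive.

Import Order.TTheory GRing.Theory Num.Theory.
Import numFieldNormedType.Exports.

Local Open Scope classical_set_scope.
Local Open Scope ring_scope.

(* Matrices, in particular 'rV[R]_d = R^d, carry their Borel sigma-algebra. *)
HB.instance Definition _ (R : realType) (m n : nat) :=
  Measurable.copy 'M[R]_(m, n) (g_sigma_algebraType (@open 'M[R]_(m, n))).

#[short(type="finMeasurableType")]
HB.structure Definition FinMeasurable d := {T of Finite T & Measurable d T}.

Section L2.
Context {d : measure_display} {T : measurableType d} {R : realType}.
Variable nu : probability T R.
Implicit Types f g : T -> R.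

(* Elements of L^2 are represented by functions; every notion below is
   insensitive to the choice of the representative. *)
Definition L2 : set (T -> R) := [set f | f \in Lfun nu 2%:E].

Definition L2norm f : \bar R := Lnorm nu 2%:E (EFin \o f).

Definition L2dot f g : R := \int[nu]_z (f z * g z).

Definition mean f : R := \int[nu]_z f z.

Definition L20 : set (T -> R) := [set f | L2 f /\ mean f = 0].

End L2.

(* An unbounded operator on L^2(nu) is given by a domain D and a function A
   which is meaningful on D only. *)
Section operators.
Context {d : measure_display} {T : measurableType d} {R : realType}.
Variable nu : probability T R.
Local Notation L2 := (L2 nu).
Local Notation norm := (L2norm nu).
Local Notation dot := (L2dot nu).
Implicit Types (S : R -> (T -> R) -> T -> R) (D F C : set (T -> R)).
Implicit Types (A : (T -> R) -> T -> R) (E : (T -> R) -> (T -> R) -> R).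
Implicit Types f g h : T -> R.

Definition strongly_continuous S := forall f, L2 f ->
  norm (fun z => S t f z - f z) @[t --> 0^'+] --> 0%E.

Definition semigroup_derivative S f g :=
  norm (fun z => t^-1 * (S t f z - f z) - g z) @[t --> 0^'+] --> 0%E.

Definition is_generator S D A :=
  (forall f, D f <->
     L2 f /\ exists g, L2 g /\ semigroup_derivative S f g) /\
  (forall f, D f -> L2 (A f) /\ semigroup_derivative S f (A f)).

Definition is_core D A C :=
  C `<=` D /\
  forall f, D f -> forall e : R, 0 < e -> exists g,
    [/\ C g, (norm (fun z => g z - f z)%R < e%:E)%E &
        (norm (fun z => A g z - A f z)%R < e%:E)%E].

Record closed_symmetric_dirichlet_form F E : Prop := {
  dform_L2 : F `<=` L2 ;
  dform_dense : forall f, L2 f -> forall e : R, 0 < e ->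
    exists g, F g /\ (norm (fun z => g z - f z)%R < e%:E)%E ;
  dform_ae : forall f f', F f -> L2 f' -> f = f' %[ae nu] ->
    F f' /\ forall g, F g -> E f g = E f' g ;
  dform_domain_linear : forall (a : R) f g, F f -> F g ->
    F (fun z => a * f z + g z) ;
  dform_linear : forall (a : R) f g h, F f -> F g -> F h ->
    E (fun z => a * f z + g z) h = a * E f h + E g h ;
  dform_sym : forall f g, F f -> F g -> E f g = E g f ;
  dform_ge0 : forall f, F f -> 0 <= E f f ;
  (* F is complete for the norm f |-> (E(f,f) + |f|^2)^(1/2) *)
  dform_closed : forall u : nat -> T -> R, (forall n, F (u n)) ->
    let E1 f := E f f + dot f f in
    (forall e : R, 0 < e -> exists N, forall m n, (N <= m)%N -> (N <= n)%N ->
       E1 (fun z => u m z - u n z) < e) ->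
    exists f, F f /\ E1 (fun z => u n z - f z) @[n --> \oo] --> (0 : R) ;
  dform_markov : forall f, F f ->
    let f01 z := Num.min (Num.max (f z) 0) 1 in
    F f01 /\ E f01 f01 <= E f f
}.

Definition is_form_operator F E D A :=
  (forall f, D f <->
     F f /\ exists h, L2 h /\ forall g, F g -> E f g = - dot h g) /\
  (forall f, D f -> L2 (A f) /\ forall g, F g -> E f g = - dot (A f) g).

Definition spectral_gap D A : \bar R :=
  ereal_inf [set (- dot (A f) f / dot f f)%:E | f in
    [set f | [/\ D f, dot f f != 0 & mean nu f = 0]]].

Definition relaxation_time S : \bar R :=
  ereal_inf [set t%:E | t in [set t : R | 0 <= t /\
    forall f, L20 nu f -> (norm (S t f) <= (expR (-1))%:E * norm f)%E]].

End operators.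

Section markov_kernels.
Context {d : measure_display} {T : measurableType d} {R : realType}.
Implicit Types (P : R -> R.-pker T ~> T) (nu : probability T R).

(* Only times t >= 0 are relevant. *)
Definition kernel_semigroup P (t : R) (f : T -> R) : T -> R :=
  fun z => \int[P t z]_w f w.

Definition markov_transition P :=
  (forall z U, measurable U -> P 0 z U = \d_z U) /\
  (forall s t, 0 <= s -> 0 <= t -> forall z U, measurable U ->
     P (s + t) z U = (\int[P s z]_w P t w U)%E).

Definition invariant_law nu P := forall t, 0 <= t -> forall U, measurable U ->
  (\int[nu]_z P t z U)%E = nu U.

Definition reversible_law nu P := forall t, 0 <= t ->
  forall U V, measurable U -> measurable V ->
  (\int[nu]_(z in U) P t z V)%E = (\int[nu]_(z in V) P t z U)%E.

End markov_kernels.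

Section euclidean.
Context {R : realType} {d : nat}.
Implicit Types (f : 'rV[R]_d -> R) (u v : 'rV[R]_d).

Definition dotv u v : R := \sum_i u 0 i * v 0 i.

(* The norm `|v| of the library is the sup norm. *)
Definition enorm v : R := Num.sqrt (dotv v v).

Definition partial (i : 'I_d) f : 'rV[R]_d -> R :=
  fun p => 'D_(delta_mx 0 i) f p.

Definition grad f (p : 'rV[R]_d) : 'rV[R]_d := \row_i partial i f p.

Definition smooth f := forall s : seq 'I_d,
  continuous (foldr partial f s) /\
  forall i p, derivable (foldr partial f s) p (delta_mx 0 i).

Definition test_function f :=
  smooth f /\ compact (closure [set p | f p != 0]).

Definition is_lebesgue (leb : {measure set 'rV[R]_d -> \bar R}) :=
  forall a b : 'rV[R]_d, (forall i, a 0 i <= b 0 i) ->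
  leb [set v | forall i, a 0 i <= v 0 i <= b 0 i] =
    (\prod_i (b 0 i - a 0 i))%:E.

Definition is_density (leb : {measure set 'rV[R]_d -> \bar R})
    (rho : probability 'rV[R]_d R) (r : 'rV[R]_d -> R) :=
  [/\ measurable_fun [set: 'rV[R]_d] r, forall p, 0 <= r p &
      forall U, measurable U -> rho U = (\int[leb]_(p in U) (r p)%:E)%E].

(* Weak gradient, so that no classical differentiability is required. *)
Definition is_weak_grad (leb : {measure set 'rV[R]_d -> \bar R})
    (r : 'rV[R]_d -> R) (gr : 'rV[R]_d -> 'rV[R]_d) :=
  forall i,
  (forall K, compact K -> leb.-integrable K (fun p => (gr p 0 i)%:E)) /\
  forall phi, test_function phi ->
    \int[leb]_p (r p * partial i phi p) = - \int[leb]_p (gr p 0 i * phi p).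

End euclidean.

Section finite_chains.
Context {dX : measure_display} {X : finMeasurableType dX} {R : realType}.
Implicit Types (A : X -> X -> R) (ppi : probability X R).

Definition mass ppi (x : X) : R := fine (ppi [set x]).

Definition rate_matrix A :=
  (forall x y, x != y -> 0 <= A x y) /\
  (forall x, A x x = - \sum_(y | y != x) A x y).

Definition vanishes_off_supp ppi A :=
  forall x y, mass ppi x = 0 \/ mass ppi y = 0 -> A x y = 0.

Definition max_rate A : R := \big[Num.max/0]_x \sum_(y | y != x) A x y.

Definition mxact A (f : X -> R) : X -> R := fun x => \sum_y A x y * f y.

(* e^(tA) f, by the exponential series *)
Definition exp_semigroup A (t : R) (f : X -> R) : X -> R :=
  fun x => limn (series (fun k => t ^+ k / k`!%:R * iter k (mxact A) f x)).

End finite_chains.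

Section lift.
Context {dX : measure_display} {X : finMeasurableType dX} {R : realType}.
Context {d : nat}.
Implicit Types (Q : 'rV[R]_d -> X -> X -> R) (ppi : probability X R).
Implicit Types (mu : X -> 'rV[R]_d -> 'rV[R]_d) (rho : probability 'rV[R]_d R).
Implicit Types (LD : ('rV[R]_d -> R) -> 'rV[R]_d -> R).
Implicit Types (f : X * 'rV[R]_d -> R).

Definition qrate ppi Q (p : 'rV[R]_d) (x : X) : R :=
  if mass ppi x == 0 then 0
  else \sum_y Q p y x * mass ppi y / mass ppi x.

Definition Qdag ppi Q (p : 'rV[R]_d) (x y : X) : R :=
  (if mass ppi x == 0 then 0 else Q p y x * mass ppi y / mass ppi x)
  - (if x == y then qrate ppi Q p x else 0).

Definition Qrev ppi Q (p : 'rV[R]_d) (x y : X) : R :=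
  2^-1 * (Q p x y + Qdag ppi Q p x y).

Definition test_function_lift f := forall x, test_function (fun p => f (x, p)).

Definition lift_formula Q mu LD (gamma : R) f : X * 'rV[R]_d -> R :=
  fun z => \sum_y Q z.2 z.1 y * f (y, z.2)
    + dotv (mu z.1 z.2) (grad (fun p => f (z.1, p)) z.2)
    + gamma * LD (fun p => f (z.1, p)) z.2.

Definition rev_formula ppi Q LD (gamma : R) f : X * 'rV[R]_d -> R :=
  fun z => \sum_y Qrev ppi Q z.2 z.1 y * f (y, z.2)
    + gamma * LD (fun p => f (z.1, p)) z.2.

Definition mean_RQrev ppi rho Q (x y : X) : R :=
  \int[rho]_p (max_rate (Q p) * Qrev ppi Q p x y).

End lift.

(* Main.v *)
(** Let [t] be a time at which the semigroup [S] of the process contracts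
    mean-zero functions by [e^-1].  For a mean-zero [g] on [X], the function
    [f (x, p) = g x] formally satisfies [Lhat f = h] with
    [h (x, p) = \sum_y Q_xy(p) (g y - g x)], so [|S_t f - f| <= t |h|], and
    contraction at time [t] forces [|f|^2 <= 4 t^2 |h|^2].  Cauchy-Schwarz with
    the weights [Q_xy(p)] bounds [|h|^2] by twice the Dirichlet form of
    [E_rho[R Q^rev]].  This is a Poincare inequality with constant [8 t^2], hence
    a relaxation time of at most [8 t^2] for that chain.

    As [f] has no compact support in [p], [S_t f - f = \int_0^t S_s h ds] is
    replaced by an approximation.  Since [1] is in the domain, the core provides
    test functions [chi] with [chi -> 1] and [Lhat chi -> 0] in [L^2]; then
    [g chi -> f] in [L^2] but [Lhat (g chi) -> h] only in [L^1], which is enough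
    because [S_t f - f] is bounded and can itself be used as a test function. *)

Require Import Defs.
From HB Require Import structures.
From mathcomp Require Import all_boot all_order all_algebra.
From mathcomp Require Import all_classical all_reals all_analysis.
From mathcomp Require Import measurable_realfun ring lra.
Import Order.TTheory GRing.Theory Num.Theory.
Import numFieldNormedType.Exports.
Local Open Scope classical_set_scope.
Local Open Scope ring_scope.

Set Implicit Arguments.
Unset Strict Implicit.
Unset Printing Implicit Defensive.

(** * Square-integrable functions on a probability space *)

(** Drift and diffusion act in [p] alone, so they commute with multiplication by [g x]. Hence
    [Lhat (g chi) - h] consists of [g * Lhat chi], which is small in L^2, and of the terms
    [Q_xy(p) (g y - g x) (chi (y, p) - 1)]. Each of the latter is a product of two L^2 functions,
    which is why only L^1 closeness is available. The constants come from [e^-1 <= 1/2]: then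
    [|S_t f|^2 <= |f|^2 / 4], and in [|f|^2 <= 2 |S_t f|^2 + 2 |S_t f - f|^2] half of [|f|^2] is
    absorbed, leaving [4 t^2]. The factor [1/2] in the Dirichlet form doubles this to [8 t^2], whose
    root is [2 sqrt 2 t]. [LD] and [Lhat] act on representatives and are determined by their
    semigroups only up to null sets, so their homogeneity on test functions and [Lhat 1 = 0] are
    recovered from uniqueness of the L^2 derivative. The factorized bound reuses the inequality
    before symmetrization and compares the rates with those of [Qbar]; no comparison between
    relaxation times of two chains is made. *)

Section integrals.
Context {d : measure_display} {T : measurableType d} {R : realType}.
Implicit Types (mu : {measure set T -> \bar R}) (nu : probability T R).
Implicit Types f g : T -> R.

Lemma bounded_integrable mu f K : mu setT = 1%E ->
  measurable_fun setT f -> (forall z, `|f z| <= K) ->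
  mu.-integrable setT (EFin \o f).
Proof.
move=> mu1 mf fK; apply: measurable_bounded_integrable => //.
  by rewrite mu1 ltry.
exists K; split; first exact: num_real.
by move=> x Kx z _; exact: le_trans (fK z) (ltW Kx).
Qed.

Lemma EFin_Rintegral mu f : mu.-integrable setT (EFin \o f) ->
  (\int[mu]_z f z)%:E = (\int[mu]_z (f z)%:E)%E.
Proof. by move=> fi; rewrite fineK// integrable_fin_num. Qed.

Lemma Rintegral_prob_cst nu (c : R) : \int[nu]_z c = c.
Proof.
have -> : \int[nu]_z c = c * fine (nu setT) by exact: Rintegral_cst.
by rewrite probability_setT mulr1.
Qed.

Lemma Rintegral_le_ae mu f g : mu.-integrable setT (EFin \o f) ->
  mu.-integrable setT (EFin \o g) ->
  {ae mu, forall z, f z <= g z} -> \int[mu]_z f z <= \int[mu]_z g z.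
Proof.
move=> fi gi fg; rewrite -subr_ge0 -RintegralB// /Rintegral.
have mf := measurable_int _ fi; have mg := measurable_int _ gi.
have mgf : measurable_fun setT (fun z => g z - f z).
  by apply: measurable_funB; exact/measurable_EFinP.
(* Almost everywhere [g - f] equals its positive part, which is nonnegative at every point. *)
rewrite (ae_eq_integral (fun z => (Num.max (g z - f z) 0)%:E))//.
- by apply: Rintegral_ge0 => z _; rewrite le_max lexx orbT.
- exact/measurable_EFinP.
- by apply/measurable_EFinP; exact: measurable_maxr.
- by apply: filterS fg => z fgz _; rewrite max_l// subr_ge0.
Qed.

Lemma integrableZl_EFin mu (c : R) f : mu.-integrable setT (EFin \o f) ->
  mu.-integrable setT (EFin \o (fun z => c * f z)).
Proof. by move=> fi; exact: (integrableZl measurableT c fi). Qed.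

Lemma integrableD_EFin mu f g : mu.-integrable setT (EFin \o f) ->
  mu.-integrable setT (EFin \o g) ->
  mu.-integrable setT (EFin \o (fun z => f z + g z)).
Proof. by move=> fi gi; exact: (integrableD measurableT fi gi). Qed.

Lemma integrable_norm_EFin mu f : mu.-integrable setT (EFin \o f) ->
  mu.-integrable setT (EFin \o (fun z => `|f z|)).
Proof. by move=> fi; exact: (integrable_norm fi). Qed.

Lemma integrableM_bounded mu f g K : measurable_fun setT f ->
  (forall z, `|f z| <= K) -> mu.-integrable setT (EFin \o g) ->
  mu.-integrable setT (EFin \o (fun z => f z * g z)).
Proof.
move=> mf fK gi; have mg : measurable_fun setT g.
  by apply/measurable_EFinP; exact: measurable_int gi.
apply: (le_integrable measurableT _ _ (integrableZl_EFin K gi)) => /=.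
  by apply/measurable_EFinP; exact: measurable_funM.
move=> z _; rewrite lee_fin !normrM ler_wpM2r//.
by rewrite (le_trans (fK z))// ler_norm.
Qed.

Lemma L2_measurable nu f : L2 nu f -> measurable_fun setT f.
Proof. by rewrite /L2 /= inE => /andP[+ _]; rewrite inE. Qed.

Lemma L2_integrable nu f : L2 nu f -> nu.-integrable setT (EFin \o f).
Proof.
move=> f2; apply/Lfun1_integrable; apply: (Lfun_subset12 _ f2).
exact: fin_num_measure.
Qed.

Lemma L2_integrable_sqr nu f : L2 nu f ->
  nu.-integrable setT (EFin \o (fun z => f z ^+ 2)).
Proof. exact: Lfun2_integrable_sqr. Qed.

Lemma L2_integrableM nu f g : L2 nu f -> L2 nu g ->
  nu.-integrable setT (EFin \o (fun z => f z * g z)).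
Proof. by move=> f2 g2; apply/Lfun1_integrable/Lfun2_mul_Lfun1. Qed.

Lemma L2norm_sqrte nu f :
  L2norm nu f = sqrte (\int[nu]_z (f z ^+ 2)%:E)%E.
Proof.
rewrite /L2norm unlock -poweR12_sqrt; last first.
  by apply: integral_ge0 => z _; rewrite lee_fin sqr_ge0.
congr poweR; apply: eq_integral => z _ /=.
by rewrite powR_mulrn// real_normK// num_real.
Qed.

Lemma integrable_sqr_L2 nu f : measurable_fun setT f ->
  nu.-integrable setT (EFin \o (fun z => f z ^+ 2)) -> L2 nu f.
Proof.
move=> mf fi; rewrite /L2 /= inE; apply/andP; split; rewrite inE//=.
rewrite /finite_norm -/(L2norm nu f) L2norm_sqrte -EFin_Rintegral//.
by rewrite /= ltry.
Qed.

Lemma L2norm_sqrt nu f : L2 nu f ->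
  L2norm nu f = (Num.sqrt (\int[nu]_z (f z ^+ 2)))%:E.
Proof.
by move=> f2; rewrite L2norm_sqrte -EFin_Rintegral//; exact: L2_integrable_sqr.
Qed.

Lemma bounded_L2 nu f K : measurable_fun setT f ->
  (forall z, `|f z| <= K) -> L2 nu f.
Proof.
move=> mf fK; apply: integrable_sqr_L2 => //.
apply: (@bounded_integrable _ _ (K ^+ 2)) => //; first exact: probability_setT.
  exact: measurable_funX.
move=> z; rewrite normrX lerXn2r// ?nnegrE//.
exact: le_trans (normr_ge0 _) (fK z).
Qed.

Lemma L2B nu f g : L2 nu f -> L2 nu g -> L2 nu (fun z => f z - g z).
Proof. 
move=> f2 g2; have [_ addC] := Lfun_addr_closed nu (lee1n 2).
by apply: (addC _ (fun z => - g z)) => //; exact: Lfun_oppr_closed.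
 Qed.

Lemma L2D nu f g : L2 nu f -> L2 nu g -> L2 nu (fun z => f z + g z).
Proof. 
move=> f2 g2; have [_ addC] := Lfun_addr_closed nu (lee1n 2).
exact: (addC f g).
 Qed.

Lemma L2Z nu c f : L2 nu f -> L2 nu (fun z => c * f z).
Proof.
move=> f2; rewrite (_ : (fun z => _) = c \o* f).
  by apply: Lfun_scale => //; lra.
by apply/funext => z /=; rewrite mulrC.
Qed.

Lemma L2norm_lt_L2 nu f (e : R) : measurable_fun setT f ->
  (L2norm nu f < e%:E)%E -> L2 nu f.
Proof.
move=> mf fe; rewrite /L2 /= inE; apply/andP; split; rewrite inE//=.
exact: lt_le_trans fe (leey _).
Qed.

Lemma L2norm_lt_sqr nu f (e : R) : measurable_fun setT f ->
  (L2norm nu f < e%:E)%E -> \int[nu]_z (f z ^+ 2) <= e ^+ 2.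
Proof.
move=> mf fe; have f2 := L2norm_lt_L2 mf fe.
move: fe; rewrite L2norm_sqrt// lte_fin => fe.
have I0 : 0 <= \int[nu]_z (f z ^+ 2) by apply: Rintegral_ge0 => z _; exact: sqr_ge0.
rewrite -(sqr_sqrtr I0) lerXn2r// ?nnegrE ?sqrtr_ge0// ?(ltW fe)//.
exact: le_trans (sqrtr_ge0 _) (ltW fe).
Qed.

(** Cauchy-Schwarz against [1], obtained by integrating [|f| <= f^2 / (2 e) + e / 2], whose defect
    is [(|f| - e)^2 / (2 e)]. *)
Lemma L2norm_lt_L1 nu f (e : R) : measurable_fun setT f ->
  (L2norm nu f < e%:E)%E -> \int[nu]_z `|f z| <= e.
Proof.
move=> mf fe; have f2 := L2norm_lt_L2 mf fe.
have e0 : 0 < e.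
  by move: fe; rewrite L2norm_sqrt// lte_fin; exact: le_lt_trans (sqrtr_ge0 _).
have c1 (c : R) : nu.-integrable setT (EFin \o (fun=> c)).
  exact: finite_measure_integrable_cst.
have fi : nu.-integrable setT (EFin \o (fun z => (2 * e)^-1 * f z ^+ 2)).
  exact/integrableZl_EFin/L2_integrable_sqr.
apply: (@le_trans _ _ (\int[nu]_z ((2 * e)^-1 * f z ^+ 2 + e / 2))).
  apply: le_Rintegral => //.
  - exact/integrable_norm_EFin/L2_integrable.
  - exact: integrableD_EFin.
  move=> z _; rewrite -subr_ge0 -(real_normK (num_real (f z))).
  suff -> : (2 * e)^-1 * `|f z| ^+ 2 + e / 2 - `|f z| =
      (2 * e)^-1 * (`|f z| - e) ^+ 2.
    by rewrite mulr_ge0 ?sqr_ge0// invr_ge0 mulr_ge0// ltW.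
  by field; rewrite gt_eqF.
rewrite RintegralD// (@RintegralZl _ _ _ nu setT (fun z => f z ^+ 2))//; last first.
  exact: L2_integrable_sqr.
rewrite Rintegral_prob_cst.
rewrite [leRHS](_ : _ = (2 * e)^-1 * e ^+ 2 + e / 2); last first.
  by field; rewrite gt_eqF.
rewrite lerD2r ler_wpM2l// ?invr_ge0 ?mulr_ge0// ?(ltW e0)//.
exact: L2norm_lt_sqr.
Qed.

End integrals.

Import HBNNSimple.

(** Simple functions increasing to [f] reduce the claim to their level sets, where it is the
    hypothesis. It serves both the Chapman-Kolmogorov identity, with [mu'] equal to [P (s + t) z],
    and invariance, with [mu'] equal to [nu]. *)
Lemma integral_mixture {d1 d2 : measure_display} {T1 : measurableType d1}
    {T2 : measurableType d2} {R : realType} (mu : {measure set T1 -> \bar R})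
    (k : R.-ker T1 ~> T2) (mu' : {measure set T2 -> \bar R})
    (f : T2 -> \bar R) :
  (forall U, measurable U -> (\int[mu]_z k z U)%E = mu' U) ->
  (forall w, (0 <= f w)%E) -> measurable_fun setT f ->
  (\int[mu]_z \int[k z]_w f w)%E = (\int[mu']_w f w)%E.
Proof.
move=> mixE f0 mf.
pose f_ := nnsfun_approx measurableT mf.
have mf_ n : measurable_fun setT (fun w => (f_ n w)%:E).
  exact/measurable_EFinP.
have f_0 n w : (0 <= (f_ n w)%:E)%E by rewrite lee_fin.
have mono w : {homo (fun n => (f_ n w)%:E) : n m / (n <= m)%N >-> (n <= m)%E}.
  by move=> a b ab; rewrite lee_fin; exact/lefP/nd_nnsfun_approx.
have approx (m : {measure set T2 -> \bar R}) : (\int[m]_w f w)%E =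
    limn (fun n => (\int[m]_w (f_ n w)%:E)%E).
  rewrite -monotone_convergence//.
  by apply: eq_integral => w _; apply/esym/cvg_lim => //; exact: cvg_nnsfun_approx.
rewrite (approx mu').
under eq_integral do rewrite approx.
rewrite monotone_convergence//; first last.
- move=> z _ a b ab; apply: ge0_le_integral => //.
  by move=> w _; exact: mono.
- by move=> n z _; exact: integral_ge0.
- by move=> n; apply: measurable_fun_integral_kernel => // U mU;
    exact: measurable_kernel.
congr (limn _); apply/funext => n.
have indicE (m : {measure set T2 -> \bar R}) :
    (\int[m]_w (f_ n w)%:E)%E =
    (\sum_(r \in range (f_ n)) r%:E * m (f_ n @^-1` [set r]))%E.
  by rewrite integralT_nnsfun sintegralE.
rewrite indicE; under eq_integral do rewrite indicE.
rewrite ge0_integral_fsum//; first last.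
- move=> r z _; have := mulemu_ge0 (fun r => f_ n @^-1` [set r]).
  by apply; exact: preimage_nnfun0.
- by move=> r; apply: measurable_funeM; exact: measurable_kernel.
apply: eq_fsbigr => r; rewrite inE => -[w _ <-].
rewrite ge0_integralZl_EFin// ?mixE//.
exact: measurable_kernel.
Qed.

(** * Displacement under a Markov semigroup *)

Section kernel_semigroups.
Context {d : measure_display} {T : measurableType d} {R : realType}.
Variable P : R -> R.-pker T ~> T.
Implicit Types (f g u v F phi : T -> R) (s t K : R).
Local Notation S := (kernel_semigroup P).

Let Pint t z f K : measurable_fun setT f -> (forall z, `|f z| <= K) ->
  (P t z).-integrable setT (EFin \o f).
Proof. by move=> mf fK; apply: (bounded_integrable _ mf fK); exact: prob_kernel. Qed.

Lemma kernel_semigroup_bound t f K z : measurable_fun setT f ->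
  (forall z, `|f z| <= K) -> `|S t f z| <= K.
Proof.
move=> mf fK; have fi := Pint t z mf fK.
rewrite (le_trans (le_normr_Rintegral measurableT fi))//.
rewrite [leRHS](_ : _ = \int[P t z]_w K); last first.
  by rewrite Rintegral_cst// prob_kernel /= mulr1.
apply: le_Rintegral => //; first exact: integrable_norm_EFin.
by apply: (@Pint _ _ _ `|K|) => //.
Qed.

(** Adding [K] makes the integrand nonnegative, so that measurability in the kernel parameter and
    the mixture formula, both about nonnegative integrands, carry over to bounded signed
    functions. *)
Lemma kernel_semigroup_shift t f K z : measurable_fun setT f ->
  (forall z, `|f z| <= K) ->
  (\int[P t z]_w (f w + K)%:E)%E = (S t f z + K)%:E.
Proof.
move=> mf fK; have fi := Pint t z mf fK.
have Ki : (P t z).-integrable setT (EFin \o (fun=> K)).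
  by apply: (@Pint _ _ _ `|K|) => //.
rewrite -EFin_Rintegral; last exact: integrableD_EFin.
by rewrite RintegralD// Rintegral_cst// prob_kernel /= mulr1.
Qed.

Lemma kernel_semigroup_measurable t f K : measurable_fun setT f ->
  (forall z, `|f z| <= K) -> measurable_fun setT (S t f).
Proof.
move=> mf fK.
have -> : S t f = (fun z => fine (\int[P t z]_w (f w + K)%:E)%E - K).
  by apply/funext => z; rewrite (kernel_semigroup_shift _ _ mf fK)/= addrK.
apply: measurable_funB => //; apply: measurableT_comp => //.
apply: measurable_fun_integral_kernel => [U mU|w|].
- exact: measurable_kernel.
- by rewrite lee_fin -lerBlDr sub0r; have := fK w; rewrite ler_norml => /andP[].
- by apply/measurable_EFinP; exact: measurable_funD.
Qed.

Lemma kernel_semigroupZ t c f K z : measurable_fun setT f ->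
  (forall z, `|f z| <= K) -> S t (fun w => c * f w) z = c * S t f z.
Proof. by move=> mf fK; rewrite /S RintegralZl//; exact: Pint mf fK. Qed.

Lemma kernel_semigroupB t f g K K' z : measurable_fun setT f ->
  (forall z, `|f z| <= K) -> measurable_fun setT g ->
  (forall z, `|g z| <= K') ->
  S t (fun w => f w - g w) z = S t f z - S t g z.
Proof.
by move=> mf fK mg gK; rewrite /S RintegralB//; [exact: Pint mf fK|exact: Pint mg gK].
Qed.

Hypothesis P_markov : markov_transition P.

Lemma kernel_semigroup0 f z : measurable_fun setT f -> S 0 f z = f z.
Proof.
move=> mf; rewrite /S/kernel_semigroup /Rintegral.
rewrite (eq_measure_integral (\d_z)); last by move=> A mA _; exact: P_markov.1.
rewrite integral_dirac//=; last exact/measurable_EFinP.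
by rewrite indicT /= mul1r.
Qed.

Lemma kernel_semigroupD s t f K z : 0 <= s -> 0 <= t ->
  measurable_fun setT f -> (forall z, `|f z| <= K) ->
  S (s + t) f z = S s (S t f) z.
Proof.
move=> s0 t0 mf fK; apply: (@addIr _ K); apply: EFin_inj.
rewrite -(kernel_semigroup_shift (s + t) z mf fK).
rewrite -(kernel_semigroup_shift s z (kernel_semigroup_measurable t mf fK)); last first.
  by move=> w; exact: kernel_semigroup_bound.
under [RHS]eq_integral do rewrite -(kernel_semigroup_shift t _ mf fK).
apply/esym/integral_mixture.
- by move=> U mU; rewrite P_markov.2.
- by move=> w; rewrite lee_fin -lerBlDr sub0r; have := fK w; rewrite ler_norml => /andP[].
- by apply/measurable_EFinP; exact: measurable_funD.
Qed.

Variable nu : probability T R.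
Hypothesis P_inv : invariant_law nu P.

(* The pair [(z, w)] runs over [nu(dz) P_s(z, dw)], both of whose marginals are
   [nu]; hence a bound on [phi z * v w] splitting into a function of [z] and a
   function of [w] can be integrated. *)
Lemma kernel_semigroup_pairing s c phi v F K K' : 0 <= s -> 0 <= c ->
  measurable_fun setT phi -> (forall z, `|phi z| <= K) ->
  measurable_fun setT v -> (forall z, `|v z| <= K') ->
  (forall z, 0 <= F z) -> nu.-integrable setT (EFin \o F) ->
  (forall z w, phi z * v w <= c * phi z ^+ 2 + F w) ->
  \int[nu]_z (phi z * S s v z) <=
    c * \int[nu]_z (phi z ^+ 2) + \int[nu]_z F z.
Proof.
move=> s0 c0 mphi phiK mv vK F0 Fi phivF.
have mF : measurable_fun setT F by exact/measurable_EFinP/(measurable_int _ Fi).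
have nu1 : nu setT = 1%E by exact: probability_setT.
have mS := kernel_semigroup_measurable s mv vK.
have phi2i : nu.-integrable setT (EFin \o (fun z => phi z ^+ 2)).
  exact/L2_integrable_sqr/(bounded_L2 nu mphi phiK).
have Si : nu.-integrable setT (EFin \o S s v).
  apply: (bounded_integrable nu1 mS) => z.
  exact: (kernel_semigroup_bound s z mv vK).
have mPF : measurable_fun setT (fun z => (\int[P s z]_w (F w)%:E)%E).
  apply: measurable_fun_integral_kernel => [U mU|w|].
  - exact: measurable_kernel.
  - by rewrite lee_fin.
  - exact/measurable_EFinP.
have PFE : (\int[nu]_z \int[P s z]_w (F w)%:E)%E = (\int[nu]_w (F w)%:E)%E.
  apply: integral_mixture; first by move=> U mU; exact: P_inv.
    by move=> w; rewrite lee_fin.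
  exact/measurable_EFinP.
have PFi : nu.-integrable setT (fun z => (\int[P s z]_w (F w)%:E)%E).
  apply/integrableP; split=> //.
  under eq_integral => z _.
    rewrite gee0_abs; last by apply: integral_ge0 => w _; rewrite lee_fin.
    over.
  by rewrite PFE -EFin_Rintegral// ltry.
rewrite -lee_fin EFinD EFin_Rintegral; last exact: (integrableM_bounded mphi phiK).
rewrite [X in (_ <= _ + X)%E]EFin_Rintegral// -PFE.
rewrite -RintegralZl// EFin_Rintegral; last exact: integrableZl_EFin.
have c2i := integrableZl_EFin c phi2i.
rewrite -integralD//.
apply: le_integral => //.
- exact: (integrableM_bounded mphi phiK).
- exact: integrableD.
move=> z _.
have Ki (r : R) : (P s z).-integrable setT (EFin \o (fun=> r)).
  by apply: (@Pint _ _ _ `|r|).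
have vi := Pint s z mv vK.
rewrite [leLHS](_ : _ = (\int[P s z]_w (phi z * v w)%:E)%E); last first.
  by rewrite -EFin_Rintegral ?RintegralZl//; exact: integrableZl_EFin.
rewrite [leRHS](_ : _ = (\int[P s z]_w ((c * phi z ^+ 2)%:E + (F w)%:E))%E); last first.
  rewrite ge0_integralD//.
  - by rewrite integral_cst// prob_kernel mule1.
  - by move=> w _; rewrite lee_fin mulr_ge0 ?sqr_ge0.
  - by move=> w _; rewrite lee_fin.
  - exact/measurable_EFinP.
(* [F] is [nu]-integrable, hence [P s z]-integrable for almost every [z] only; where its integral is
   infinite the bound is trivial. *)
have [Fz|/negbTE Fz] := boolP ((\int[P s z]_w (F w)%:E)%E < +oo)%E.
  apply: le_integral => //.
  - exact: integrableZl_EFin.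
  - apply: integrableD => //; first exact: Ki.
    apply/integrableP; split; first exact/measurable_EFinP.
    by under eq_integral do rewrite gee0_abs ?lee_fin//.
  by move=> w _; rewrite -EFinD lee_fin.
rewrite ge0_integralD//.
- rewrite integral_cst// prob_kernel mule1.
  have /eqP -> : (\int[P s z]_w (F w)%:E)%E == +oo%E.
    by rewrite -[_ == _]negbK -ltey Fz.
  by rewrite addey// leey.
- by move=> w _; rewrite lee_fin mulr_ge0 ?sqr_ge0.
- by move=> w _; rewrite lee_fin.
- exact/measurable_EFinP.
Qed.

(** [S_((n+1)s) u - u] is [S_(ns) u - u] plus [S_(ns)] applied to the single increment [S_s u - u].
    By invariance the pairing bound charges each such term the same amount, whatever the time
    [ns]. *)
Lemma kernel_semigroup_telescope s n phi u c F K K' : 0 <= s -> 0 <= c ->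
  measurable_fun setT phi -> (forall z, `|phi z| <= K) ->
  measurable_fun setT u -> (forall z, `|u z| <= K') ->
  (forall z, 0 <= F z) -> nu.-integrable setT (EFin \o F) ->
  (forall z w, phi z * (S s u w - u w) <= c * phi z ^+ 2 + F w) ->
  \int[nu]_z (phi z * (S (n%:R * s) u z - u z)) <=
    n%:R * (c * \int[nu]_z (phi z ^+ 2) + \int[nu]_z F z).
Proof.
move=> s0 c0 mphi phiK mu uK F0 Fi phiF.
have mS t : measurable_fun setT (S t u) by exact: kernel_semigroup_measurable mu uK.
have SK t z : `|S t u z| <= K' by exact: kernel_semigroup_bound.
have mD t : measurable_fun setT (fun z => S t u z - u z).
  by apply: measurable_funB.
have DK t z : `|S t u z - u z| <= K' + K'.
  by rewrite (le_trans (ler_normB _ _))// lerD.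
have nu1 : nu setT = 1%E by exact: probability_setT.
have phiDi t : nu.-integrable setT (EFin \o (fun z => phi z * (S t u z - u z))).
  by apply: (integrableM_bounded mphi phiK); exact: bounded_integrable (DK t).
elim: n => [|n IH].
  rewrite !mul0r; under eq_Rintegral do rewrite kernel_semigroup0// subrr mulr0.
  by rewrite Rintegral_cst// mul0r.
have ns0 : 0 <= n%:R * s by rewrite mulr_ge0.
have -> : \int[nu]_z (phi z * (S (n.+1%:R * s) u z - u z)) =
    \int[nu]_z (phi z * (S (n%:R * s) u z - u z)) +
    \int[nu]_z (phi z * S (n%:R * s) (fun w => S s u w - u w) z).
  rewrite -RintegralD//; last first.
    apply: (integrableM_bounded mphi phiK); apply: bounded_integrable => //.
      exact: kernel_semigroup_measurable (DK s).
    by move=> z; exact: kernel_semigroup_bound (DK s).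
  apply: eq_Rintegral => z _; rewrite -mulrDr; congr (_ * _).
  rewrite (kernel_semigroupB _ _ (mS s) (SK s) mu uK).
  rewrite -(kernel_semigroupD z ns0 s0 mu uK) -[n.+1]addn1 natrD mulrDl mul1r.
  by rewrite [RHS]addrC addrA subrK.
rewrite -[n.+1]addn1 natrD mulrDl mul1r; apply: lerD => //.
exact: (kernel_semigroup_pairing ns0 c0 mphi phiK (mD s) (DK s)).
Qed.

(* Telescoping over [n] steps of length [t / n] replaces the formula
   [S_t u - u = \int_0^t S_s w ds] and so avoids vector-valued integration.  The
   part [a] of [w] is measured in [L^2], the rest in [L^1] against the bound [K]
   of [phi]. *)
Lemma kernel_semigroup_increment t phi u w a K K' : 0 < t ->
  measurable_fun setT phi -> (forall z, `|phi z| <= K) ->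
  measurable_fun setT u -> (forall z, `|u z| <= K') ->
  L2 nu a -> L2 nu w -> semigroup_derivative nu S u w ->
  \int[nu]_z (phi z * (S t u z - u z)) <=
    2^-1 * \int[nu]_z (phi z ^+ 2) + 2^-1 * t ^+ 2 * \int[nu]_z (a z ^+ 2)
    + t * K * \int[nu]_z `|w z - a z|.
Proof.
move=> t0 mphi phiK mu uK a2 w2 uw.
have mS s : measurable_fun setT (S s u) by exact: kernel_semigroup_measurable mu uK.
have SK s z : `|S s u z| <= K' by exact: kernel_semigroup_bound.
have K0 : 0 <= K by exact: le_trans (normr_ge0 _) (phiK point).
have mw := L2_measurable w2; have ma := L2_measurable a2.
apply/ler_addgt0Pr => e e0.
(* The difference quotient will miss [w] by at most [e'] in L^1, at the cost [t * K * e' <= e]; the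
   [+ 1] covers [K = 0]. *)
pose e' := e / (t * K + 1).
have tK1 : 0 < t * K + 1 by rewrite ltr_wpDl// mulr_ge0// ltW.
have e'0 : 0 < e' by rewrite divr_gt0.
have [n n0 ne] : exists2 n, (0 < n)%N &
    (L2norm nu (fun z => (t / n%:R)^-1 * (S (t / n%:R) u z - u z) - w z)%R
       < e'%:E)%E.
  have : \forall s \near 0^'+, (L2norm nu
      (fun z => s^-1 * (S s u z - u z) - w z)%R < e'%:E)%E.
    have /= := uw; rewrite /semigroup_derivative => /(_ [set x | (x < e'%:E)%E]).
    by apply; apply: open_nbhs_nbhs; split => //=; exact: open_ereal_lt_ereal.
  rewrite near_withinE => -[r /= r0 rP].
  (* The successor makes [t / n < r] strict, so that one step lies where the difference quotient is
     close to [w]. *)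
  pose n := (Num.truncn (t / r)).+1.
  have n0 : 0 < n%:R :> R by rewrite ltr0n.
  exists n => //; apply: rP => /=; last by rewrite divr_gt0.
  rewrite sub0r normrN gtr0_norm ?divr_gt0// ltr_pdivrMr// mulrC -ltr_pdivrMr//.
  exact: truncnS_gt.
have nR0 : 0 < n%:R :> R by rewrite ltr0n.
set s := t / n%:R in ne.
have s0 : 0 < s by rewrite divr_gt0.
pose c z := s^-1 * (S s u z - u z) - a z.
have c2 : L2 nu c.
  apply: L2B => //; apply: L2Z; apply: L2B.
    exact: bounded_L2 (mS s) (SK s).
  exact: bounded_L2 mu uK.
have r2 : L2 nu (fun z => s^-1 * (S s u z - u z) - w z).
  apply: L2B => //; apply: L2Z; apply: L2B.
    exact: bounded_L2 (mS s) (SK s).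
  exact: bounded_L2 mu uK.
have wa2 := L2B w2 a2.
have cle : \int[nu]_z `|c z| <= e' + \int[nu]_z `|w z - a z|.
  have rle := L2norm_lt_L1 (L2_measurable r2) ne.
  apply: le_trans (lerD rle (lexx _)).
  rewrite -RintegralD//; [|exact/integrable_norm_EFin/L2_integrable..].
  apply: le_Rintegral => //; first exact/integrable_norm_EFin/L2_integrable.
    by apply: integrableD_EFin; exact/integrable_norm_EFin/L2_integrable.
  move=> z _; rewrite -[c z](subrKA (w z)); exact: ler_normD.
(* One step gets the share [1 / n] of the bound: Young's inequality treats the product of [phi] and
   [t * a], and the bound [K] of [phi] treats the remainder [c]. *)
pose F z := n%:R^-1 * (2^-1 * t ^+ 2 * a z ^+ 2 + t * K * `|c z|).
have Fi1 : nu.-integrable setT (EFin \o (fun z => 2^-1 * t ^+ 2 * a z ^+ 2)).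
  exact/integrableZl_EFin/L2_integrable_sqr.
have Fi2 : nu.-integrable setT (EFin \o (fun z => t * K * `|c z|)).
  exact/integrableZl_EFin/integrable_norm_EFin/L2_integrable.
have Fi12 := integrableD_EFin Fi1 Fi2.
have Fi : nu.-integrable setT (EFin \o F) by exact: integrableZl_EFin.
have F0 z : 0 <= F z.
  rewrite mulr_ge0 ?invr_ge0// addr_ge0//.
    by rewrite mulr_ge0 ?sqr_ge0// mulr_ge0 ?invr_ge0 ?sqr_ge0.
  by rewrite !mulr_ge0// ltW.
have phiF z z' : phi z * (S s u z' - u z') <= n%:R^-1 * 2^-1 * phi z ^+ 2 + F z'.
  have -> : S s u z' - u z' = n%:R^-1 * t * (a z' + c z').
    have -> : n%:R^-1 * t = s by rewrite mulrC.
    by rewrite /c [a _ + _]addrC subrK mulrA divff ?mul1r// gt_eqF.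
  have -> : phi z * (n%:R^-1 * t * (a z' + c z')) =
      n%:R^-1 * (t * (phi z * a z') + t * (phi z * c z')) by ring.
  have -> : n%:R^-1 * 2^-1 * phi z ^+ 2 + F z' = n%:R^-1 *
      (2^-1 * phi z ^+ 2 + (2^-1 * t ^+ 2 * a z' ^+ 2 + t * K * `|c z'|)).
    by rewrite /F; ring.
  rewrite ler_pM2l ?invr_gt0//.
  have h1 : phi z * c z' <= K * `|c z'|.
    by rewrite (le_trans (ler_norm _))// normrM ler_wpM2r.
  have h2 : t * (phi z * c z') <= t * (K * `|c z'|) by rewrite ler_pM2l.
  have h3 : 0 <= (phi z - t * a z') ^+ 2 by exact: sqr_ge0.
  nra.
have n20 : 0 <= n%:R^-1 * 2^-1 :> R by rewrite mulr_ge0// invr_ge0.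
have := kernel_semigroup_telescope n (ltW s0) n20 mphi phiK mu uK F0 Fi phiF.
have -> : n%:R * s = t by rewrite mulrC divfK// gt_eqF.
move/le_trans; apply.
rewrite RintegralZl// -[n%:R^-1 / 2 * _]mulrA -mulrDr mulVKf ?gt_eqF// RintegralD//.
rewrite (@RintegralZl _ _ _ nu setT (fun z => a z ^+ 2))//; last exact: L2_integrable_sqr.
rewrite (@RintegralZl _ _ _ nu setT (fun z => `|c z|))//; last first.
  exact/integrable_norm_EFin/L2_integrable.
rewrite !addrA -[leRHS]addrA lerD2l.
apply: (@le_trans _ _ (t * K * (e' + \int[nu]_z `|w z - a z|))).
  by rewrite ler_wpM2l// mulr_ge0// ltW.
rewrite mulrDr [leLHS]addrC lerD2l /e' mulrCA ger_pMr// ler_pdivrMr// mul1r.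
by rewrite lerDl.
Qed.

(** With [phi = S_t f - f] as its own test function, the increment bound has half of [\int phi^2] on
    the right. Absorbing it into the left side turns the factor [t^2 / 2] into [t^2]. *)
Lemma kernel_semigroup_displacement t f h K : 0 <= t ->
  measurable_fun setT f -> (forall z, `|f z| <= K) -> L2 nu h ->
  (forall e, 0 < e -> exists u w K', [/\ measurable_fun setT u,
     forall z, `|u z| <= K', semigroup_derivative nu S u w, L2 nu w &
     \int[nu]_z `|u z - f z| <= e /\ \int[nu]_z `|w z - h z| <= e]) ->
  \int[nu]_z ((S t f z - f z) ^+ 2) <= t ^+ 2 * \int[nu]_z (h z ^+ 2).
Proof.
rewrite le_eqVlt => /predU1P[<-|t0] mf fK h2 approx.
  under eq_Rintegral do rewrite kernel_semigroup0// subrr expr0n/=.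
  by rewrite Rintegral_cst// expr0n/= !mul0r.
have mS : measurable_fun setT (S t f) by exact: kernel_semigroup_measurable mf fK.
have SK z : `|S t f z| <= K by exact: kernel_semigroup_bound.
pose phi z := S t f z - f z.
have mphi : measurable_fun setT phi by exact: measurable_funB.
have phiK z : `|phi z| <= 2 * K.
  by rewrite (le_trans (ler_normB _ _))// mulr_natl mulr2n lerD.
have K0 : 0 <= K by exact: le_trans (normr_ge0 _) (fK point).
suff H : \int[nu]_z (phi z ^+ 2) <=
    2^-1 * \int[nu]_z (phi z ^+ 2) + 2^-1 * t ^+ 2 * \int[nu]_z (h z ^+ 2).
  move: H; rewrite /phi.
  set A := \int[nu]_z _; set B := \int[nu]_z _ => H; lra.
apply/ler_addgt0Pr => e e0.
(* [C] collects the coefficients of the L^1 errors: [t * (2 * K)] for [w - h], and [2 * K] for each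
   of the terms [S_t v] and [v] that arise when [f] is replaced by [u]. *)
pose C := t * (2 * K) + 2 * K + 2 * K + 1.
have C0 : 0 < C by rewrite ltr_wpDl// !addr_ge0// !mulr_ge0// ltW.
have [u [w [K' [mu uK uw w2 [uf wh]]]]] := approx (e / C) (divr_gt0 e0 C0).
pose v z := f z - u z.
have mv : measurable_fun setT v by exact: measurable_funB.
have vK z : `|v z| <= K + K' by rewrite (le_trans (ler_normB _ _))// lerD.
have nu1 : nu setT = 1%E by exact: probability_setT.
have vi := bounded_integrable nu1 mv vK.
have vE : \int[nu]_z `|v z| = \int[nu]_z `|u z - f z|.
  by apply: eq_Rintegral => z _; rewrite distrC.
have mSu : measurable_fun setT (S t u) by exact: kernel_semigroup_measurable mu uK.
have SuK z : `|S t u z| <= K' by exact: kernel_semigroup_bound.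
have mSv : measurable_fun setT (S t v) by exact: kernel_semigroup_measurable mv vK.
have SvK z : `|S t v z| <= K + K' by exact: kernel_semigroup_bound.
have phii g M : measurable_fun setT g -> (forall z, `|g z| <= M) ->
    nu.-integrable setT (EFin \o (fun z => phi z * g z)).
  by move=> mg gM; apply: (integrableM_bounded mphi phiK); exact: bounded_integrable gM.
have I1 := kernel_semigroup_increment t0 mphi phiK mu uK h2 w2 uw.
(* The pairing bound with [c = 0]: no square of [phi] is spent, only its bound [2 * K]. *)
have I2 : \int[nu]_z (phi z * S t v z) <= 2 * K * \int[nu]_z `|v z|.
  have := @kernel_semigroup_pairing t 0 phi v (fun z => 2 * K * `|v z|) _ _
    (ltW t0) (lexx _) mphi phiK mv vK.
  rewrite mul0r add0r RintegralZl//; last exact: integrable_norm_EFin.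
  apply.
  - by move=> z; rewrite !mulr_ge0.
  - exact/integrableZl_EFin/integrable_norm_EFin.
  move=> z z'; rewrite mul0r add0r (le_trans (ler_norm _))// normrM.
  by rewrite ler_wpM2r.
have I3 : - (\int[nu]_z (phi z * v z)) <= 2 * K * \int[nu]_z `|v z|.
  apply: le_trans (ler_norm _) _; rewrite normrN.
  rewrite (le_trans (le_normr_Rintegral measurableT _))//; first exact: (phii v _ mv vK).
  rewrite -RintegralZl//; last exact: integrable_norm_EFin.
  apply: le_Rintegral => //.
  - exact/integrable_norm_EFin/(phii v _ mv vK).
  - exact/integrableZl_EFin/integrable_norm_EFin.
  by move=> z _; rewrite normrM ler_wpM2r.
have phi2E : \int[nu]_z (phi z ^+ 2) = \int[nu]_z (phi z * (S t u z - u z)) +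
    \int[nu]_z (phi z * S t v z) - \int[nu]_z (phi z * v z).
  have i1 := phii _ _ mSv SvK.
  have i2 := phii _ _ mv vK.
  have i3 : nu.-integrable setT (EFin \o (fun z => phi z * (S t u z - u z))).
    apply: (phii _ (K' + K')); first exact: measurable_funB.
    by move=> z; rewrite (le_trans (ler_normB _ _))// lerD.
  rewrite -RintegralD// -RintegralB//; last exact: integrableD_EFin.
  apply: eq_Rintegral => z _; rewrite -mulrDr -mulrBr expr2; congr (_ * _).
  by rewrite (kernel_semigroupB _ _ mf fK mu uK) /phi /v; ring.
rewrite phi2E.
have eC : \int[nu]_z `|v z| <= e / C by rewrite vE.
have J : t * (2 * K) * \int[nu]_z `|w z - h z| + 2 * K * \int[nu]_z `|v z|
    + 2 * K * \int[nu]_z `|v z| <= e.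
  have -> : e = C * (e / C) by rewrite mulrC divfK// gt_eqF.
  have X0 := divr_gt0 e0 C0.
  move: X0 wh eC; set X := e / C => X0 wh eC; rewrite /C.
  have K20 : 0 <= 2 * K by rewrite mulr_ge0.
  have tK0 : 0 <= t * (2 * K) by rewrite mulr_ge0// ltW.
  have := ler_wpM2l tK0 wh; have := ler_wpM2l K20 eC; lra.
rewrite -phi2E; move: I1 I2 I3 J; rewrite phi2E; lra.
Qed.

End kernel_semigroups.

(** * Relaxation of finite reversible chains *)

Section finite_integrals.
Context {dX : measure_display} {X : finMeasurableType dX} {R : realType}.
Hypothesis X_discrete : forall U : set X, measurable U.

Lemma discrete_measurable_fun {d : measure_display} {T : measurableType d}
  (f : X -> T) : measurable_fun setT f.
Proof. by move=> _ Y mY; exact: X_discrete. Qed.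

Lemma ge0_integral_finite (mu : {measure set X -> \bar R}) (f : X -> \bar R) :
  (forall x, (0 <= f x)%E) ->
  (\int[mu]_x f x = \sum_x f x * mu [set x])%E.
Proof.
move=> f0.
have -> : [set: X] = \big[setU/set0]_(x <- enum X) [set x].
  apply/seteqP; split=> // x _; rewrite -bigcup_seq; exists x => //=.
  by rewrite mem_enum.
rewrite ge0_integral_bigsetU//=.
- rewrite -big_enum /=; apply: eq_bigr => x _.
  rewrite (@eq_integral _ _ _ _ _ (cst (f x))); last first.
    by move=> y; rewrite inE /= => ->.
  by rewrite integral_cst.
- exact: enum_uniq.
- apply/trivIsetP => x y _ _ xy; apply/seteqP; split=> // z [/= -> /eqP].
  by rewrite (negbTE xy).
Qed.

Variable ppi : probability X R.
Local Notation m := (mass ppi).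

Lemma mass_ge0 x : 0 <= m x. Proof. by rewrite fine_ge0. Qed.

Lemma EFin_mass x : (m x)%:E = ppi [set x].
Proof. by rewrite fineK// fin_num_measure. Qed.

Lemma Rintegral_finite_ge0 (f : X -> R) : (forall x, 0 <= f x) ->
  (\int[ppi]_x (f x)%:E)%E = (\sum_x m x * f x)%:E.
Proof.
move=> f0; rewrite ge0_integral_finite => [|x]; last by rewrite lee_fin.
rewrite -sumEFin; apply: eq_bigr => x _; rewrite mulrC EFinM.
by congr (_ * _)%E; exact/esym/EFin_mass.
Qed.

Lemma sum_mass : \sum_x m x = 1.
Proof.
transitivity (\sum_x m x * 1); first by apply: eq_bigr => x _; rewrite mulr1.
apply: EFin_inj; rewrite -(Rintegral_finite_ge0 (f := fun=> 1))//.
by rewrite -EFin_Rintegral ?Rintegral_prob_cst//; exact: finite_measure_integrable_cst.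
Qed.

Lemma Rintegral_finite (f : X -> R) : \int[ppi]_x f x = \sum_x m x * f x.
Proof.
pose K := \sum_x `|f x|.
have fK x : `|f x| <= K by rewrite /K (bigD1 x)//= lerDl sumr_ge0.
have nu1 : ppi setT = 1%E by exact: probability_setT.
have fi := bounded_integrable nu1 (discrete_measurable_fun f) fK.
have Ki : ppi.-integrable setT (EFin \o (fun=> K)).
  exact: finite_measure_integrable_cst.
apply: (@addIr _ K); rewrite -{1}[K](Rintegral_prob_cst ppi) -RintegralD//.
rewrite /Rintegral Rintegral_finite_ge0/=; last first.
  by move=> x; rewrite -lerBlDr sub0r; have := fK x; rewrite ler_norml => /andP[].
under eq_bigr do rewrite mulrDr.
by rewrite big_split /= -mulr_suml sum_mass mul1r.
Qed.

Lemma L2norm_finite (f : X -> R) :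
  L2norm ppi f = (Num.sqrt (\sum_x m x * f x ^+ 2))%:E.
Proof.
by rewrite L2norm_sqrte Rintegral_finite_ge0// => x; exact: sqr_ge0.
Qed.

End finite_integrals.

(** * Differentiability of the exponential semigroup of a finite matrix *)

Lemma is_derive_sum_seq {R : realType} {I : Type} (r : seq I)
    (h : I -> R -> R) (dh : I -> R) (t : R) :
  (forall i, is_derive t 1 (h i) (dh i)) ->
  is_derive t 1 (fun s => \sum_(i <- r) h i s) (\sum_(i <- r) dh i).
Proof.
move=> hd; elim: r => [|i r IH].
  under eq_fun do rewrite big_nil; rewrite big_nil; exact: is_derive_cst.
under eq_fun do rewrite big_cons; rewrite big_cons; exact: is_deriveD.
Qed.

Section exponential.
Context {dX : measure_display} {X : finMeasurableType dX} {R : realType}.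
Variable A : X -> X -> R.
Implicit Types (f g : X -> R) (t : R).
Local Notation u := (exp_semigroup A).

Let coef f x k := iter k (mxact A) f x / k`!%:R.

Lemma exp_semigroupE t f x : u t f x = limn (pseries (coef f x) t).
Proof.
rewrite /exp_semigroup /pseries; congr (limn (series _)).
by apply/funext => k; rewrite /coef /= [LHS]mulrC mulrA mulrAC.
Qed.

(** [M] and [K] serve all [x] and [k] at once, so the exponential series is dominated by a scalar
    one and converges for every [t]. *)
Lemma iter_mxact_bound f : exists M K, forall x k,
  `|iter k (mxact A) f x| <= K * M ^+ k.
Proof.
pose M := \sum_x \sum_y `|A x y|; pose K := \sum_x `|f x|.
have M0 : 0 <= M by apply: sumr_ge0 => x _; exact: sumr_ge0.
exists M, K => x k; elim: k x => [|k IH] x.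
  by rewrite expr0 mulr1 /K (bigD1 x)//= lerDl sumr_ge0.
rewrite iterS /mxact (le_trans (ler_norm_sum _ _ _))//.
apply: (@le_trans _ _ (\sum_y `|A x y| * (K * M ^+ k))).
  by apply: ler_sum => y _; rewrite normrM ler_wpM2l.
rewrite -mulr_suml exprS [leRHS]mulrCA ler_wpM2r//.
  by rewrite mulr_ge0 ?exprn_ge0// sumr_ge0.
by rewrite /M [leRHS](bigD1 x)//= lerDl sumr_ge0// => y _; rewrite sumr_ge0.
Qed.

Lemma is_cvg_exp_semigroup t f x : cvgn (pseries (coef f x) t).
Proof.
have [M [K fM]] := iter_mxact_bound f.
apply: normed_cvg.
apply: (@series_le_cvg _ _ (fun k => `|K| * exp_coeff (`|M| * `|t|) k)).
- by move=> k /=; exact: normr_ge0.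
- by move=> k; rewrite mulr_ge0// exp_coeff_ge0// mulr_ge0.
- move=> k /=; rewrite /coef /exp_coeff /= !normrM normrX normfV normr_nat.
  rewrite exprMn !mulrA mulrAC ler_wpM2r ?invr_ge0// ler_wpM2r ?exprn_ge0//.
  by rewrite (le_trans (fM x k))// (le_trans (ler_norm _))// normrM normrX.
rewrite (_ : series _ = `|K| *: series (exp_coeff (`|M| * `|t|))).
  by apply: is_cvgZr; exact: is_cvg_series_exp_coeff.
by apply/funext => n; rewrite /series /= fctE /= scaler_sumr.
Qed.

(** The shift of coefficients cancels one factor of the factorial and leaves one more application of
    [A]: the derived series is the exponential series started from [mxact A f]. *)
Lemma pseries_diffs_coef f x :
  pseries_diffs (coef f x) = coef (mxact A f) x.
Proof.
apply/funext => k; rewrite /pseries_diffs /coef -iterSr factS natrM invfM.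
by rewrite mulrCA mulVKf.
Qed.

Lemma exp_semigroup0 f x : u 0 f x = f x.
Proof.
rewrite exp_semigroupE; apply: cvg_lim => //; rewrite -cvg_shiftS.
rewrite (_ : (fun n => _) = fun=> f x); first exact: cvg_cst.
apply/funext => n; rewrite /pseries /series /= big_nat_recl//= big1 ?addr0.
  by rewrite /coef /= expr0 mulr1 fact0 divr1.
by move=> i _; rewrite exprS mul0r mulr0.
Qed.

Lemma exp_semigroup_mxact t f x : u t (mxact A f) x = mxact A (u t f) x.
Proof.
rewrite exp_semigroupE; apply: cvg_lim => //.
rewrite (_ : pseries _ _ = (fun n => \sum_y A x y * pseries (coef f y) t n)).
  apply: cvg_big => [|y _].
    exact: add_continuous.
  apply: cvgMr; rewrite exp_semigroupE; exact: is_cvg_exp_semigroup.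
apply/funext => n; rewrite /pseries /series /=.
under [RHS]eq_bigr do rewrite mulr_sumr.
rewrite exchange_big /=; apply: eq_bigr => k _.
rewrite /coef -iterSr iterS /mxact !mulr_suml; apply: eq_bigr => y _.
by rewrite !mulrA.
Qed.

Lemma is_derive_exp_semigroup t f x :
  is_derive t 1 (fun s => u s f x) (mxact A (u t f) x).
Proof.
rewrite -exp_semigroup_mxact exp_semigroupE -pseries_diffs_coef.
under eq_fun do rewrite exp_semigroupE.
apply: (@pseries_snd_diffs _ _ (`|t| + 1)).
- exact: is_cvg_exp_semigroup.
- by rewrite pseries_diffs_coef; exact: is_cvg_exp_semigroup.
- by rewrite !pseries_diffs_coef; exact: is_cvg_exp_semigroup.
by rewrite [ltRHS]ger0_norm ?addr_ge0// ltrDl.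
Qed.

End exponential.

(** * From a Poincare inequality to a relaxation time *)

Section relaxation_from_poincare.
Context {dX : measure_display} {X : finMeasurableType dX} {R : realType}.
Hypothesis X_discrete : forall U : set X, measurable U.
Variables (ppi : probability X R) (A : X -> X -> R).
Implicit Types (f g : X -> R) (t : R).
Local Notation m := (mass ppi).

Definition dirichlet g : R :=
  2^-1 * \sum_x \sum_y m x * A x y * (g y - g x) ^+ 2.

Hypothesis A_row : forall x, \sum_y A x y = 0.
Hypothesis A_sym : forall x y, m x * A x y = m y * A y x.

(** When the square is expanded, the terms in [g x ^+ 2] vanish by the zero row sums and those in
    [g y ^+ 2] by symmetry as well; the cross terms remain. *)
Lemma dirichletE g : \sum_x m x * (g x * mxact A g x) = - dirichlet g.
Proof.
have sq1 : \sum_x \sum_y m x * A x y * g x ^+ 2 = 0.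
  apply: big1 => x _; rewrite -mulr_suml -mulr_sumr A_row mulr0 mul0r//.
have sq2 : \sum_x \sum_y m x * A x y * g y ^+ 2 = 0.
  rewrite exchange_big /= -[RHS]sq1; apply: eq_bigr => x _.
  by apply: eq_bigr => y _; rewrite A_sym.
have -> : dirichlet g = 2^-1 * (\sum_x \sum_y m x * A x y * g x ^+ 2
    + \sum_x \sum_y m x * A x y * g y ^+ 2
    - 2 * \sum_x \sum_y m x * A x y * (g x * g y)).
  rewrite /dirichlet; congr (_ * _).
  rewrite mulr_sumr -big_split /= -sumrB; apply: eq_bigr => x _.
  rewrite mulr_sumr -big_split /= -sumrB; apply: eq_bigr => y _; ring.
rewrite sq1 sq2 addr0 sub0r mulrN opprK mulKf ?pnatr_eq0//.
apply: eq_bigr => x _; rewrite /mxact !mulr_sumr; apply: eq_bigr => y _; ring.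
Qed.

Lemma sum_mass_mxact g : \sum_x m x * mxact A g x = 0.
Proof.
rewrite (eq_bigr (fun x => \sum_y m x * A x y * g y)); last first.
  by move=> x _; rewrite /mxact mulr_sumr; apply: eq_bigr => y _; rewrite mulrA.
rewrite exchange_big big1// => y _; rewrite -mulr_suml.
by under eq_bigr do rewrite A_sym; rewrite -mulr_sumr A_row mulr0 mul0r.
Qed.

Lemma exp_semigroup_mean t f :
  \sum_x m x * exp_semigroup A t f x = \sum_x m x * f x.
Proof.
transitivity (\sum_x m x * exp_semigroup A 0 f x); last first.
  by apply: eq_bigr => x _; rewrite exp_semigroup0.
pose M s := \sum_x m x * exp_semigroup A s f x.
apply: (@is_derive_0_is_cst _ M) => s.
rewrite -(sum_mass_mxact (exp_semigroup A s f)).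
apply: is_derive_sum_seq => x.
have := is_deriveZ (m x) (is_derive_exp_semigroup A s f x).
by [].
Qed.

Variable C : R.
Hypothesis poincare : forall g, \sum_x m x * g x = 0 ->
  \sum_x m x * g x ^+ 2 <= C * dirichlet g.

(** A Gronwall argument: the mean stays zero, so the Poincare inequality gives [V' = - 2 * dirichlet
    (u t) <= - (2 / C) * V]. Hence [W] is nonincreasing, and at time [C] its exponential factor is
    exactly [e^2]. *)
Lemma exp_semigroup_decay f : 0 < C -> \sum_x m x * f x = 0 ->
  \sum_x m x * exp_semigroup A C f x ^+ 2 <=
    expR (-1) ^+ 2 * \sum_x m x * f x ^+ 2.
Proof.
move=> C0 f0.
pose u t := exp_semigroup A t f.
pose V t := \sum_x m x * u t x ^+ 2.
pose W t := V t * expR (2 / C * t).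
pose dW t := V t * (expR (2 / C * t) * (2 / C))
  + expR (2 / C * t) * (2 * \sum_x m x * (u t x * mxact A (u t) x)).
have dV t : is_derive t 1 V (2 * \sum_x m x * (u t x * mxact A (u t) x)).
  rewrite mulr_sumr; apply: is_derive_sum_seq => x.
  have du := is_derive_exp_semigroup A t f x.
  have := is_deriveZ (m x) (is_deriveX 2 du).
  rewrite (_ : _ *: _ = 2 * (m x * (u t x * mxact A (u t) x)))//.
  by rewrite /GRing.scale /= expr1 /u; ring.
have dE t : is_derive t 1 (fun s => expR (2 / C * s)) (expR (2 / C * t) * (2 / C)).
  have dl : is_derive t 1 (fun s : R => 2 / C * s) (2 / C).
    have := is_deriveZ (2 / C) (is_derive_id t (1 : R)).
    by rewrite /GRing.scale /= mulr1.
  have := @is_derive1_comp _ expR (fun s => 2 / C * s) t _ _ (is_derive_expR _) dl.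
  by [].
have dWt t : is_derive t 1 W (dW t).
  exact: (is_deriveM (dV t) (dE t)).
have W'le t : dW t <= 0.
  rewrite /dW dirichletE; set e := expR _.
  have -> : V t * (e * (2 / C)) + e * (2 * - dirichlet (u t)) =
      e * (V t * (2 / C) - 2 * dirichlet (u t)) by ring.
  rewrite pmulr_rle0 ?expR_gt0//.
  have := poincare (etrans (exp_semigroup_mean t f) f0); rewrite -/(V t) -/(u t).
  set D := dirichlet _ => VD; have : V t * (2 / C) <= C * D * (2 / C).
    by rewrite ler_pM2r// divr_gt0.
  have -> : C * D * (2 / C) = 2 * D by field; rewrite gt_eqF.
  lra.
have cW : continuous W.
  move=> t; apply: differentiable_continuous; apply/derivable1_diffP.
  exact: (@ex_derive _ _ _ _ _ _ _ (dWt t)).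
have : W C <= W 0.
  apply: (@ler0_derive1_nincr _ W 0 C) => //.
  - by move=> t _; rewrite derive1E (@derive_val _ _ _ _ _ _ _ (dWt t)).
  - exact: continuous_subspaceT.
  - exact: ltW.
rewrite /W mulr0 expR0 mulr1 divfK ?gt_eqF// => VC.
have -> : \sum_x m x * f x ^+ 2 = V 0.
  by apply: eq_bigr => x _; rewrite /u exp_semigroup0.
by rewrite -/(V C) -expRM_natl mulrN1 expRN [leRHS]mulrC ler_pdivlMr ?expR_gt0.
Qed.

Lemma relaxation_time_poincare : 0 <= C ->
  (relaxation_time ppi (exp_semigroup A) <= C%:E)%E.
Proof.
move=> C0; apply: ereal_inf_lbound; exists C => //; split=> // f [_ f0].
rewrite /mean Rintegral_finite// in f0.
rewrite !L2norm_finite// -EFinM lee_fin.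
rewrite -[expR _]ger0_norm ?expR_ge0// -sqrtr_sqr -sqrtrM ?sqr_ge0//.
apply: ler_wsqrtr.
(* For [C = 0] there is no rate [2 / C], but the Poincare inequality makes [f] vanish where [ppi]
   has mass, so time [0] works. This case arises when the lifted process already contracts at
   [t = 0]. *)
move: C0; rewrite le_eqVlt => /predU1P[C0|C0]; last exact: exp_semigroup_decay.
have := poincare f0; rewrite -C0 mul0r => V0.
under eq_bigr do rewrite exp_semigroup0.
apply: (le_trans V0); rewrite mulr_ge0 ?sqr_ge0// sumr_ge0// => x _.
by rewrite mulr_ge0 ?sqr_ge0// mass_ge0.
Qed.

End relaxation_from_poincare.

(** * Finite sums, uniqueness of semigroup derivatives, and products with a finite space *)

Section sums.
Context {d : measure_display} {T : measurableType d} {R : realType}.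
Variable mu : {measure set T -> \bar R}.

Lemma integrable_sum_EFin {I : Type} (r : seq I) (P : pred I) (f : I -> T -> R) :
  (forall i, mu.-integrable setT (EFin \o f i)) ->
  mu.-integrable setT (EFin \o (fun z => \sum_(i <- r | P i) f i z)).
Proof.
move=> fi; elim: r => [|i r IH].
  by under [X in EFin \o X]eq_fun do rewrite big_nil; exact: integrable0.
under [X in EFin \o X]eq_fun do rewrite big_cons.
by case: (P i) => //; exact: integrableD_EFin.
Qed.

Lemma Rintegral_sum {I : Type} (r : seq I) (P : pred I) (f : I -> T -> R) :
  (forall i, mu.-integrable setT (EFin \o f i)) ->
  \int[mu]_z (\sum_(i <- r | P i) f i z) =
  \sum_(i <- r | P i) \int[mu]_z f i z.
Proof.
move=> fi; elim: r => [|i r IH].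
  under eq_Rintegral do rewrite big_nil.
  by rewrite big_nil /Rintegral integral0.
under eq_Rintegral do rewrite big_cons; rewrite big_cons -IH.
case: (P i) => //; rewrite RintegralD//; exact: integrable_sum_EFin.
Qed.

End sums.

Lemma L2_sum {d : measure_display} {T : measurableType d} {R : realType}
    (nu : probability T R) {I : Type} (r : seq I) (P : pred I) (f : I -> T -> R) :
  (forall i, L2 nu (f i)) -> L2 nu (fun z => \sum_(i <- r | P i) f i z).
Proof.
move=> fi; elim: r => [|i r IH].
  under eq_fun do rewrite big_nil.
  by apply: (@bounded_L2 _ _ _ _ _ 0) => // z; rewrite normr0.
under eq_fun do rewrite big_cons.
by case: (P i) => //; exact: L2D.
Qed.

Lemma L2_dominated {d : measure_display} {T : measurableType d} {R : realType}
    (nu : probability T R) (f g : T -> R) : measurable_fun setT f ->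
  (forall z, `|f z| <= g z) -> L2 nu g -> L2 nu f.
Proof.
move=> mf fg g2; apply: integrable_sqr_L2 => //.
apply: (le_integrable measurableT _ _ (L2_integrable_sqr g2)).
  by apply/measurable_EFinP; exact: measurable_funX.
move=> z _ /=; rewrite lee_fin !normrX lerXn2r// ?nnegrE//.
by rewrite (le_trans (fg z))// ler_norm.
Qed.

(** Uniqueness of the L^2 limit gives homogeneity of a generator almost everywhere. With [g1 = 0] it
    also shows that a function whose increments vanish is sent to [0]. *)
Lemma kernel_semigroup_derivative_unique {d : measure_display}
    {T : measurableType d} {R : realType} (nu : probability T R)
    (P : R -> R.-pker T ~> T) (f g1 g2 : T -> R) (c K : R) :
  measurable_fun setT f -> (forall z, `|f z| <= K) -> L2 nu g1 -> L2 nu g2 ->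
  semigroup_derivative nu (kernel_semigroup P) f g1 ->
  semigroup_derivative nu (kernel_semigroup P) (fun z => c * f z) g2 ->
  {ae nu, forall z, g2 z = c * g1 z}.
Proof.
move=> mf fK L1 L2' d1 d2.
have Dm := L2B L2' (L2Z c L1).
have mS t : measurable_fun setT (kernel_semigroup P t f).
  exact: kernel_semigroup_measurable mf fK.
have small : \int[nu]_z `|g2 z - c * g1 z| <= 0.
  apply/ler_addgt0Pr => e e0; rewrite add0r.
  pose e' := e / (1 + `|c|).
  have c1 : 0 < 1 + `|c| by rewrite ltr_pwDl.
  have e'0 : 0 < e' by rewrite divr_gt0.
  have lim0 g h : semigroup_derivative nu (kernel_semigroup P) g h ->
      \forall t \near 0^'+, (L2norm nu (fun z =>
        t^-1 * (kernel_semigroup P t g z - g z) - h z)%R < e'%:E)%E.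
    move=> /(_ [set x | (x < e'%:E)%E]); apply.
    by apply: open_nbhs_nbhs; split => //=; exact: open_ereal_lt_ereal.
  have [t [t1 t2]] := filter_ex (filterI (lim0 _ _ d1) (lim0 _ _ d2)).
  pose r1 z := t^-1 * (kernel_semigroup P t f z - f z) - g1 z.
  pose r2 z := t^-1 * (kernel_semigroup P t (fun z => c * f z) z - c * f z) - g2 z.
  have mr1 : measurable_fun setT r1.
    apply: measurable_funB; last exact: L2_measurable L1.
    by apply: measurable_funM => //; apply: measurable_funB.
  have mr2 : measurable_fun setT r2.
    apply: measurable_funB; last exact: L2_measurable L2'.
    apply: measurable_funM => //; apply: measurable_funB; last exact: measurable_funM.
    rewrite (_ : kernel_semigroup _ _ _ = fun z => c * kernel_semigroup P t f z).
      exact: measurable_funM.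
    by apply/funext => z; rewrite (kernel_semigroupZ P t c _ mf fK).
  have i1 := integrable_norm_EFin (L2_integrable (L2norm_lt_L2 mr1 t1)).
  have i2 := integrable_norm_EFin (L2_integrable (L2norm_lt_L2 mr2 t2)).
  apply: (@le_trans _ _ (\int[nu]_z (`|r2 z| + `|c| * `|r1 z|))).
    apply: le_Rintegral => //.
    - exact/integrable_norm_EFin/L2_integrable.
    - exact/integrableD_EFin/integrableZl_EFin.
    move=> z _; rewrite -normrM.
    have -> : g2 z - c * g1 z = c * r1 z - r2 z.
      by rewrite /r1 /r2 (kernel_semigroupZ P t c _ mf fK); ring.
    by rewrite [leRHS]addrC ler_normB.
  rewrite RintegralD//; last exact: integrableZl_EFin.
  rewrite RintegralZl//.
  apply: (@le_trans _ _ (e' + `|c| * e')).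
    by rewrite lerD ?ler_wpM2l//; exact: L2norm_lt_L1.
  by rewrite -{1}[e']mul1r -mulrDl /e' mulrC divfK// gt_eqF.
have z0 : (\int[nu]_z `|(g2 z - c * g1 z)%:E| = 0)%E.
  transitivity (\int[nu]_z `|g2 z - c * g1 z|)%:E.
    by rewrite EFin_Rintegral//; exact/integrable_norm_EFin/L2_integrable.
  congr EFin; apply/eqP; rewrite eq_le small /=.
  exact: Rintegral_ge0.
have := z0; rewrite ae_eq_integral_abs//; last first.
  by apply/measurable_EFinP; exact: L2_measurable Dm.
by apply: filterS => z /(_ Logic.I)[] /eqP; rewrite subr_eq0 => /eqP.
Qed.

Section products.
Context {dX : measure_display} {X : finMeasurableType dX} {R : realType}.
Context {d : measure_display} {T : measurableType d}.
Hypothesis X_discrete : forall U : set X, measurable U.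
Variables (ppi : probability X R) (rho : probability T R).
Local Notation m := (mass ppi).
Local Notation nu := (ppi \x rho)%E.

Lemma measurable_fun_sections {d' : measure_display} {T' : measurableType d'}
    (f : X * T -> T') :
  (forall x, measurable_fun setT (fun p => f (x, p))) -> measurable_fun setT f.
Proof.
move=> mf _ Y mY; rewrite setTI.
rewrite (_ : f @^-1` Y =
    \bigcup_(x in [set: X]) ([set x] `*` ((fun p => f (x, p)) @^-1` Y))).
  apply: fin_bigcup_measurable; first exact: finite_finset.
  move=> x _; apply: measurableX => //.
  by have := mf x measurableT _ mY; rewrite setTI.
apply/seteqP; split=> [[x p] Yxp|[x p] [y _ [/= -> ]]]//.
by exists x.
Qed.

Lemma ge0_integral_sections (f : X * T -> R) : measurable_fun setT f ->
  (forall z, 0 <= f z) ->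
  (forall x, rho.-integrable setT (EFin \o (fun p => f (x, p)))) ->
  (\int[nu]_z (f z)%:E)%E = (\sum_x m x * \int[rho]_p f (x, p))%:E.
Proof.
move=> mf f0 fi; rewrite (fubini_tonelli1 (EFin \o f)) /=; first last.
- by move=> z; rewrite lee_fin.
- exact/measurable_EFinP.
rewrite /fubini_F /=.
rewrite (eq_integral (fun x => (\int[rho]_p f (x, p))%:E)); last first.
  by move=> x _; rewrite EFin_Rintegral.
by rewrite (Rintegral_finite_ge0 X_discrete)// => x; exact: Rintegral_ge0.
Qed.

Lemma integrable_sections (f : X * T -> R) : 
  (forall x, rho.-integrable setT (EFin \o (fun p => f (x, p)))) ->
  nu.-integrable setT (EFin \o f).
Proof.
move=> fi.
have mf : measurable_fun setT f.
  by apply: measurable_fun_sections => x; exact/measurable_EFinP/(measurable_int _ (fi x)).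
apply/integrableP; split; first exact/measurable_EFinP.
under eq_integral do rewrite /=.
rewrite (@ge0_integral_sections (fun z => `|f z|)) ?ltry//.
- exact: measurableT_comp.
- by move=> x; exact: integrable_norm_EFin.
Qed.

Lemma Rintegral_sections_ge0 (f : X * T -> R) : (forall z, 0 <= f z) ->
  (forall x, rho.-integrable setT (EFin \o (fun p => f (x, p)))) ->
  \int[nu]_z f z = \sum_x m x * \int[rho]_p f (x, p).
Proof.
move=> f0 fi; rewrite {1}/Rintegral ge0_integral_sections//.
apply: measurable_fun_sections => x.
exact/measurable_EFinP/(measurable_int _ (fi x)).
Qed.

Lemma L2_sections (f : X * T -> R) : (forall x, L2 rho (fun p => f (x, p))) ->
  L2 nu f.
Proof.
move=> f2; apply: integrable_sqr_L2.
  by apply: measurable_fun_sections => x; exact: L2_measurable (f2 x).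
by apply: integrable_sections => x; exact: L2_integrable_sqr (f2 x).
Qed.

Lemma Rintegral_fst (g : X -> R) : \int[nu]_z g z.1 = \sum_x m x * g x.
Proof.
pose K := \sum_x `|g x|.
have gK x : `|g x| <= K by rewrite /K (bigD1 x)//= lerDl sumr_ge0.
have cst_i (c : R) : rho.-integrable setT (EFin \o (fun=> c)).
  exact: finite_measure_integrable_cst.
have gi : nu.-integrable setT (EFin \o (fun z : X * T => g z.1)).
  by apply: integrable_sections => x; exact: (cst_i (g x)).
have Ki : nu.-integrable setT (EFin \o (fun=> K)).
  by apply: integrable_sections => x; exact: (cst_i K).
apply: (@addIr _ K); rewrite -{1}[K](Rintegral_prob_cst nu) -RintegralD//.
rewrite Rintegral_sections_ge0/=; first last.
- by move=> x; exact: (cst_i (g x + K)).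
- by move=> z; rewrite -lerBlDr sub0r; have := gK z.1; rewrite ler_norml => /andP[].
under eq_bigr do rewrite Rintegral_prob_cst mulrDr.
by rewrite big_split /= -mulr_suml (sum_mass X_discrete) mul1r.
Qed.

(** The exceptional null set may depend on [x], but [X] is finite. This permits scaling constants
    that vary with [x], such as [g x]. *)
Lemma ae_sections (P : X -> T -> Prop) : (forall x, {ae rho, forall p, P x p}) ->
  {ae nu, forall z, P z.1 z.2}.
Proof.
move=> Pae.
have : {ae rho, forall p, forall x, P x p}.
  exact: (@filter_forall _ _ _ _ _ Pae).
move=> [B [mB B0 PB]]; exists (setT `*` B); split.
- exact: measurableX.
- by rewrite product_measure1E//= B0 mule0.
- move=> [x p] /= nP; split=> //=; apply: PB => /= Pp; apply: nP; exact: Pp.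
Qed.

End products.

(** * Test functions, scaling of gradients, and Cauchy-Schwarz inequalities *)

Section test_functions.
Context {R : realType} {d : nat}.
Implicit Types (f : 'rV[R]_d -> R) (p : 'rV[R]_d).

Lemma continuous_rV_measurable f : continuous f -> measurable_fun setT f.
Proof.
move=> cf; apply: (@measurability _ _ _ _ _ _ (@RGenOInfty.G R)).
  exact: RGenOInfty.measurableE.
move=> _ [_ [a ->] <-]; rewrite setTI; apply: sub_sigma_algebra.
by apply: open_comp => // p _; exact: cf.
Qed.

Lemma test_function_measurable f : test_function f -> measurable_fun setT f.
Proof. by case=> sf _; apply: continuous_rV_measurable; have [] := sf [::]. Qed.

Lemma test_function_bounded f : test_function f ->
  exists K, forall p, `|f p| <= K.
Proof.
move=> [sf cf]; have [cont _] := sf [::].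
have : compact (f @` closure [set p | f p != 0]).
  by apply: continuous_compact => //; exact: continuous_subspaceT.
move=> /compact_bounded[M [_ MP]]; exists (`|M| + 1) => p.
have [fp0|fp0] := eqVneq (f p) 0; first by rewrite fp0 normr0 addr_ge0.
apply: (MP (`|M| + 1)); first by rewrite ltr_pwDr// ler_norm.
by exists p => //; exact: subset_closure.
Qed.

Lemma partialZ (c : R) i f p : derivable f p (delta_mx 0 i) ->
  partial i (fun q => c * f q) p = c * partial i f p.
Proof. by move=> df; rewrite /partial; exact: (@deriveZ _ _ _ f c). Qed.

Lemma foldr_partialZ (c : R) f s : smooth f ->
  foldr partial (fun q => c * f q) s = (fun q => c * foldr partial f s q).
Proof.
move=> sf; elim: s => [//|i s IH] /=; rewrite IH.
by apply/funext => p; rewrite partialZ//; have [_] := sf s; exact.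
Qed.

Lemma test_functionZ (c : R) f : test_function f ->
  test_function (fun q => c * f q).
Proof.
move=> [sf cf]; split.
  move=> s; rewrite foldr_partialZ//; have [cs ds] := sf s; split.
    move=> p; have Fp : Filter (nbhs p) by exact: (@nbhs_filter 'rV[R]_d p).
    exact: cvgMr (cs p).
  by move=> i p; exact: (@derivableZ _ _ _ (foldr partial f s) c).
apply: (subclosed_compact _ cf); first exact: closed_closure.
by apply: closureS => p /=; apply: contra => /eqP ->; rewrite mulr0.
Qed.

Lemma gradZ (c : R) f p : smooth f ->
  grad (fun q => c * f q) p = c *: grad f p.
Proof.
move=> sf; apply/rowP => i; rewrite !mxE partialZ//.
by have [_] := sf [::]; exact.
Qed.

Lemma dotvZr (c : R) (u v : 'rV[R]_d) : dotv u (c *: v) = c * dotv u v.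
Proof.
rewrite /dotv mulr_sumr; apply: eq_bigr => i _; rewrite mxE; ring.
Qed.

(** The difference of the squares is the squared norm of the component of [v] orthogonal to [u]. *)
Lemma dotv_unit_le_enorm (u v : 'rV[R]_d) : enorm u = 1 -> `|dotv u v| <= enorm v.
Proof.
move=> u1; have uu : dotv u u = 1.
  rewrite -[LHS]sqr_sqrtr; last by apply: sumr_ge0 => i _; rewrite -expr2 sqr_ge0.
  by rewrite -/(enorm u) u1 expr1n.
rewrite -sqrtr_sqr ler_wsqrtr// -subr_ge0.
have -> : dotv v v - dotv u v ^+ 2 = \sum_i (v 0 i - dotv u v * u 0 i) ^+ 2.
  rewrite (eq_bigr (fun i => v 0 i * v 0 i - 2 * dotv u v * (u 0 i * v 0 i)
    + dotv u v ^+ 2 * (u 0 i * u 0 i))); last by move=> i _; ring.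
  by rewrite big_split /= sumrB -!mulr_sumr -/(dotv u v) -/(dotv v v) -/(dotv u u) uu; ring.
by apply: sumr_ge0 => i _; exact: sqr_ge0.
Qed.

End test_functions.

(** Lagrange's identity: the defect is half the double sum of [w i * w j * (a i - a j) ^+ 2]. *)
Lemma weighted_sqr_sum_le {R : realType} {I : finType} (P : pred I)
    (w a : I -> R) : (forall i, P i -> 0 <= w i) ->
  (\sum_(i | P i) w i * a i) ^+ 2 <=
    (\sum_(i | P i) w i) * \sum_(i | P i) w i * a i ^+ 2.
Proof.
move=> w0; rewrite -subr_ge0.
have -> : (\sum_(i | P i) w i) * (\sum_(i | P i) w i * a i ^+ 2) -
    (\sum_(i | P i) w i * a i) ^+ 2 =
    2^-1 * \sum_(i | P i) \sum_(j | P j) w i * w j * (a i - a j) ^+ 2.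
  pose S k l := \sum_(i | P i) \sum_(j | P j) (w i * a i ^+ k) * (w j * a j ^+ l).
  have SE k l : S k l = (\sum_(i | P i) w i * a i ^+ k) * \sum_(i | P i) w i * a i ^+ l.
    by rewrite mulr_suml; apply: eq_bigr => i _; rewrite mulr_sumr.
  have -> : \sum_(i | P i) \sum_(j | P j) w i * w j * (a i - a j) ^+ 2 =
      S 2 0%N + S 0%N 2 - 2 * S 1%N 1%N.
    rewrite mulr_sumr -big_split -sumrB /=; apply: eq_bigr => i _.
    rewrite mulr_sumr -big_split -sumrB /=; apply: eq_bigr => j _; ring.
  rewrite !SE.
  have -> : \sum_(i | P i) w i * a i ^+ 0 = \sum_(i | P i) w i.
    by apply: eq_bigr => i _; rewrite expr0 mulr1.
  have -> : \sum_(i | P i) w i * a i ^+ 1 = \sum_(i | P i) w i * a i by [].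
  by field.
rewrite mulr_ge0 ?invr_ge0// sumr_ge0// => i Pi; rewrite sumr_ge0// => j Pj.
by rewrite mulr_ge0 ?sqr_ge0// mulr_ge0 ?w0.
Qed.

(** * Averaged rates and their symmetrization *)

Section rates.
Context {dX : measure_display} {X : finMeasurableType dX} {R : realType}.
Context {d : nat}.
Variables (ppi : probability X R) (rho : probability 'rV[R]_d R).
Variable Q : 'rV[R]_d -> X -> X -> R.
Hypothesis Q_rate : forall p, rate_matrix (Q p).
Hypothesis Q_supp : forall p, vanishes_off_supp ppi (Q p).
Hypothesis Q_L2 : forall x y, L2 rho (fun p => Q p x y).
Local Notation m := (mass ppi).

Lemma rate_matrix_row (A : X -> X -> R) x : rate_matrix A -> \sum_y A x y = 0.
Proof. by move=> [_ diag]; rewrite (bigD1 x)//= diag addNr. Qed.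

Lemma max_rate_ge0 (A : X -> X -> R) : 0 <= max_rate A.
Proof. by apply/bigmax_geP; left. Qed.

Lemma le_max_rate (A : X -> X -> R) x : \sum_(y | y != x) A x y <= max_rate A.
Proof. by apply/bigmax_geP; right; exists x. Qed.

(** The maximum is dominated by the sum of all off-diagonal rates. Its square integrability makes
    the products averaged in [mean_RQ] and [mean_RQrev] integrable. *)
Lemma max_rate_L2 : L2 rho (fun p => max_rate (Q p)).
Proof.
apply: (@L2_dominated _ _ _ _ _ (fun p => \sum_x \sum_(y | y != x) Q p x y)).
- pose G x p := \sum_(y | y != x) Q p x y.
  have mG x : measurable_fun setT (G x).
    by apply: (@L2_measurable _ _ _ rho); apply: L2_sum => y; exact: Q_L2.
  rewrite (_ : (fun p => _) = (fun p => \big[Num.max/0]_x G x p))//.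
  elim: (index_enum X) => [|x r IH].
    by under eq_fun do rewrite big_nil; exact: measurable_cst.
  by under eq_fun do rewrite big_cons; exact: measurable_maxr.
- move=> p; have Q0 x : 0 <= \sum_(y | y != x) Q p x y.
    by apply: sumr_ge0 => y yx; apply: (Q_rate p).1; rewrite eq_sym.
  rewrite ger0_norm ?max_rate_ge0//; apply: bigmax_le; first exact: sumr_ge0.
  by move=> x _; rewrite [leRHS](bigD1 x)//= lerDl sumr_ge0.
- by apply: L2_sum => x; apply: L2_sum => y; exact: Q_L2.
Qed.

(** These are the rates that Cauchy-Schwarz yields for the jump part, before symmetrization with
    respect to [ppi]. *)
Definition mean_RQ x y : R := \int[rho]_p (max_rate (Q p) * Q p x y).

Lemma max_rateM_integrable x y :
  rho.-integrable setT (EFin \o (fun p => max_rate (Q p) * Q p x y)).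
Proof. by apply: L2_integrableM => //; exact: max_rate_L2. Qed.

(** The correction [q] lives on the diagonal. Where [m x = 0] the transposed entry is read as [0],
    in agreement with [Q_supp], which makes [Q p y x] vanish. *)
Lemma mass_Qrev p x y : x != y ->
  m x * Qrev ppi Q p x y = 2^-1 * (m x * Q p x y + m y * Q p y x).
Proof.
move=> xy; rewrite /Qrev /Qdag (negbTE xy) subr0.
have [mx0|mx0] := eqVneq (m x) 0; last by field.
by rewrite mx0 (Q_supp p (or_intror mx0)) !(mul0r, mulr0, addr0).
Qed.

(** [qrate] is the row sum of the transposed part of [Qdag], so its subtraction on the diagonal
    cancels that row. *)
Lemma Qrev_row p x : \sum_y Qrev ppi Q p x y = 0.
Proof.
rewrite /Qrev -mulr_sumr big_split /= (rate_matrix_row _ (Q_rate p)) add0r.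
rewrite /Qdag sumrB -big_mkcond /= [X in _ - X](eq_bigl (pred1 x)) ?big_pred1_eq; last first.
  by move=> y /=; rewrite eq_sym.
by rewrite /qrate; case: (m x == 0); first rewrite big1//; rewrite subrr mulr0.
Qed.

Lemma Qrev_L2 x y : L2 rho (fun p => Qrev ppi Q p x y).
Proof.
apply: L2Z; apply: L2D => //; apply: L2B.
  case: (m x == 0); first by apply: (@bounded_L2 _ _ _ _ _ 0) => // p; rewrite normr0.
  under eq_fun do rewrite -mulrA mulrC; exact: L2Z.
case: (x == y); last by apply: (@bounded_L2 _ _ _ _ _ 0) => // p; rewrite normr0.
rewrite /qrate; case: (m x == 0).
  by apply: (@bounded_L2 _ _ _ _ _ 0) => // p; rewrite normr0.
apply: L2_sum => z; under eq_fun do rewrite -mulrA mulrC; exact: L2Z.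
Qed.

Lemma mean_RQrev_row x : \sum_y mean_RQrev ppi rho Q x y = 0.
Proof.
rewrite /mean_RQrev -Rintegral_sum; last first.
  by move=> y; apply: L2_integrableM; [exact: max_rate_L2|exact: Qrev_L2].
under eq_Rintegral do rewrite -mulr_sumr Qrev_row mulr0.
exact: Rintegral_prob_cst.
Qed.

Lemma mass_mean_RQrev x y : x != y -> m x * mean_RQrev ppi rho Q x y =
  2^-1 * (m x * mean_RQ x y + m y * mean_RQ y x).
Proof.
move=> xy; rewrite -RintegralZl//; last first.
  by apply: L2_integrableM; [exact: max_rate_L2|exact: Qrev_L2].
under eq_Rintegral do rewrite mulrCA mass_Qrev// mulrCA mulrDr !(mulrCA _ (m _)).
have iQ x' y' := max_rateM_integrable x' y'.
rewrite RintegralZl//; last by apply: integrableD_EFin; exact: integrableZl_EFin.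
by rewrite RintegralD ?RintegralZl//; exact: integrableZl_EFin.
Qed.

Lemma mean_RQrev_sym x y :
  m x * mean_RQrev ppi rho Q x y = m y * mean_RQrev ppi rho Q y x.
Proof.
have [->//|xy] := eqVneq x y.
rewrite (mass_mean_RQrev xy) mass_mean_RQrev 1?eq_sym//.
by congr (_ * _); exact: addrC.
Qed.

(** The squared increments are symmetric in [x] and [y], so only the symmetrized rates count; off
    the diagonal these are given by [mean_RQrev], and on it the increment is zero. *)
Lemma dirichlet_mean_RQrev (g : X -> R) :
  \sum_x \sum_y m x * mean_RQ x y * (g y - g x) ^+ 2 =
  2 * dirichlet ppi (mean_RQrev ppi rho Q) g.
Proof.
rewrite /dirichlet mulVKf ?pnatr_eq0//.
set S := LHS.
have S' : S = \sum_x \sum_y m y * mean_RQ y x * (g y - g x) ^+ 2.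
  rewrite /S exchange_big /=; apply: eq_bigr => x _; apply: eq_bigr => y _.
  by congr (_ * _); rewrite -sqrrN opprB.
have -> : S = 2^-1 * (S + S) by field.
rewrite {2}S' /S -big_split mulr_sumr /=; apply: eq_bigr => x _.
rewrite -big_split mulr_sumr /=; apply: eq_bigr => y _.
have [->|xy] := eqVneq x y; first by rewrite subrr expr0n /= !mulr0 addr0 mulr0.
by rewrite mass_mean_RQrev// -mulrDl mulrA.
Qed.

End rates.

(* For [k = 0] the factor is [0^-1 = 0]. *)
Lemma sqrte_relaxation_le {R : realType} (s : \bar R) (t k : R) :
  0 <= t -> 0 <= k -> (s <= (8 * t ^+ 2 * k)%:E)%E ->
  (((2 * Num.sqrt (2 * k))^-1)%:E * sqrte s <= t%:E)%E.
Proof.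
move=> t0 k0 sle; set c := 2 * _.
have c0 : 0 <= c by rewrite mulr_ge0.
have cE : sqrte (8 * t ^+ 2 * k)%:E = (c * t)%:E.
  congr EFin; have -> : 8 * t ^+ 2 * k = (2 * t) ^+ 2 * (2 * k) by ring.
  rewrite sqrtrM ?sqr_ge0// sqrtr_sqr ger0_norm ?mulr_ge0// /c; ring.
apply: (@le_trans _ _ ((c^-1)%:E * (c * t)%:E)%E).
  apply: lee_wpmul2l; first by rewrite lee_fin invr_ge0.
  by rewrite -cE lee_sqrt// lee_fin !mulr_ge0 ?sqr_ge0.
rewrite -EFinM lee_fin.
have [->|cN0] := eqVneq c 0; first by rewrite invr0 mul0r.
by rewrite mulKf.
Qed.

(** * The lifted process *)

Section lifted_process.
Context {dX : measure_display} {X : finMeasurableType dX} {R : realType}.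
Context {d : nat}.
Hypothesis X_discrete : forall U : set X, measurable U.
Variables (ppi : probability X R) (rho : probability 'rV[R]_d R).
Variable Q : 'rV[R]_d -> X -> X -> R.
Hypothesis Q_rate : forall p, rate_matrix (Q p).
Hypothesis Q_supp : forall p, vanishes_off_supp ppi (Q p).
Hypothesis Q_L2 : forall x y, L2 rho (fun p => Q p x y).
Local Notation m := (mass ppi).
Local Notation nu := (ppi \x rho)%E.

Definition jump_part (g : X -> R) (z : X * 'rV[R]_d) : R :=
  \sum_y Q z.2 z.1 y * (g y - g z.1).

Lemma jump_part_L2 g : L2 nu (jump_part g).
Proof.
apply: (L2_sections X_discrete) => x; apply: L2_sum => y /=.
by under eq_fun do rewrite mulrC; exact: L2Z.
Qed.

Lemma jump_part_sqr_le g : \int[nu]_z (jump_part g z ^+ 2) <=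
  \sum_x \sum_y m x * mean_RQ rho Q x y * (g y - g x) ^+ 2.
Proof.
rewrite (Rintegral_sections_ge0 X_discrete); first last.
- move=> x; apply: (@L2_integrable_sqr _ _ _ rho).
  apply: L2_sum => y /=; under eq_fun do rewrite mulrC; exact: L2Z.
- by move=> z; exact: sqr_ge0.
apply: ler_sum => x _.
under eq_bigr do rewrite -mulrA; rewrite -mulr_sumr.
apply: ler_wpM2l; first exact: mass_ge0.
have iQ y : rho.-integrable setT
    (EFin \o (fun p => (g y - g x) ^+ 2 * (max_rate (Q p) * Q p x y))).
  exact/integrableZl_EFin/max_rateM_integrable.
apply: (@le_trans _ _
    (\int[rho]_p \sum_y (g y - g x) ^+ 2 * (max_rate (Q p) * Q p x y))).
  apply: le_Rintegral => //.
  - apply: (@L2_integrable_sqr _ _ _ rho).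
    apply: L2_sum => y /=; under eq_fun do rewrite mulrC; exact: L2Z.
  - exact: integrable_sum_EFin.
  (* The diagonal rate is nonpositive and cannot serve as a weight; its term is zero and is removed
     before Cauchy-Schwarz. *)
  move=> p _; rewrite /jump_part /= (bigD1 x)//= subrr mulr0 add0r.
  have Q0 y : y != x -> 0 <= Q p x y by move=> yx; apply: (Q_rate p).1; rewrite eq_sym.
  apply: (le_trans (weighted_sqr_sum_le _ Q0)).
  rewrite [leRHS](bigD1 x)//= subrr expr0n /= mul0r add0r.
  apply: (@le_trans _ _ (max_rate (Q p) * \sum_(i | i != x) Q p x i * (g i - g x) ^+ 2)).
    apply: ler_wpM2r; last exact: le_max_rate.
    by apply: sumr_ge0 => y yx; rewrite mulr_ge0 ?sqr_ge0 ?Q0.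
  by rewrite mulr_sumr; apply: ler_sum => y _; rewrite mulrA mulrC.
rewrite Rintegral_sum//; apply: ler_sum => y _.
rewrite /mean_RQ [leRHS]mulrC -RintegralZl//.
exact: max_rateM_integrable.
Qed.

(** The inverse masses turn smallness under [nu] into smallness on the slice over each [y]; a point
    of mass [0] contributes [0^-1 = 0]. *)
Let jump_const : R :=
  \sum_x \sum_y \int[rho]_p (Q p x y ^+ 2) + \sum_y (m y)^-1.

(** Young's inequality in the form [a b <= delta a^2 / 2 + b^2 / (2 delta)]. For [m y > 0] the slice
    of [chi - 1] over [y] has squared norm at most [delta^2 / m y], so both terms are of order
    [delta]. *)
Lemma jump_truncation_error (chi : X * 'rV[R]_d -> R) (delta : R) x : 0 < delta ->
  (forall y, L2 rho (fun p => chi (y, p) - 1)) ->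
  \int[nu]_z ((chi z - 1) ^+ 2) <= delta ^+ 2 ->
  \int[rho]_p (\sum_y `|Q p x y| * `|chi (y, p) - 1|) <=
    2^-1 * delta * jump_const.
Proof.
move=> delta0 chi2 chile.
have q0 x' y : 0 <= \int[rho]_p (Q p x' y ^+ 2).
  by apply: Rintegral_ge0 => p _; exact: sqr_ge0.
have c2i y : rho.-integrable setT (EFin \o (fun p => (chi (y, p) - 1) ^+ 2)).
  exact: L2_integrable_sqr.
have Q2i x' y : rho.-integrable setT (EFin \o (fun p => Q p x' y ^+ 2)).
  exact: L2_integrable_sqr.
have cle y : m y * \int[rho]_p ((chi (y, p) - 1) ^+ 2) <= delta ^+ 2.
  apply: le_trans chile; rewrite (Rintegral_sections_ge0 X_discrete)//; last first.
    by move=> z; exact: sqr_ge0.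
  rewrite [leRHS](bigD1 y)//= lerDl sumr_ge0// => x' _.
  by rewrite mulr_ge0 ?mass_ge0// Rintegral_ge0// => p _; exact: sqr_ge0.
have Qci y : rho.-integrable setT (EFin \o (fun p => `|Q p x y| * `|chi (y, p) - 1|)).
  under [X in EFin \o X]eq_fun do rewrite -normrM.
  exact/integrable_norm_EFin/L2_integrableM.
rewrite Rintegral_sum//.
apply: (@le_trans _ _ (\sum_y (2^-1 * delta * \int[rho]_p (Q p x y ^+ 2)
    + 2^-1 * delta * (m y)^-1))).
  apply: ler_sum => y _.
  (* [m y * (m y)^-1] is [0] when [m y = 0], where [Q p x y] vanishes as well. *)
  pose k := 2^-1 * delta^-1 * (m y * (m y)^-1).
  apply: (@le_trans _ _ (\int[rho]_p (2^-1 * delta * Q p x y ^+ 2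
      + k * (chi (y, p) - 1) ^+ 2))).
    apply: le_Rintegral => //.
      by apply: integrableD_EFin; exact: integrableZl_EFin.
    move=> p _; rewrite /k.
    have [my0|my0] := eqVneq (m y) 0.
      rewrite (Q_supp p (or_intror my0)) normr0 mul0r my0 !(mul0r, mulr0).
      by rewrite expr0n /= mulr0 addr0.
    rewrite divff// mulr1 -(real_normK (num_real (Q _ _ _))).
    rewrite -(real_normK (num_real (chi _ - 1))) -subr_ge0.
    set a := `|Q _ _ _|; set b := `|_ - 1|.
    have -> : 2^-1 * delta * a ^+ 2 + 2^-1 / delta * b ^+ 2 - a * b =
        2^-1 * delta^-1 * (delta * a - b) ^+ 2 by field; rewrite gt_eqF.
    by rewrite mulr_ge0 ?sqr_ge0// mulr_ge0 ?invr_ge0 ?ltW.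
  rewrite RintegralD//; [|exact: integrableZl_EFin..].
  rewrite !RintegralZl// lerD2l /k.
  have -> : 2^-1 / delta * (m y / m y) * \int[rho]_p (chi (y, p) - 1) ^+ 2 =
    2^-1 * (m y)^-1 * (delta^-1 * (m y * \int[rho]_p (chi (y, p) - 1) ^+ 2)) by ring.
  have -> : 2^-1 * delta / m y = 2^-1 * (m y)^-1 * (delta^-1 * delta ^+ 2).
    by rewrite expr2 mulKf ?gt_eqF//; ring.
  apply: ler_wpM2l; first by rewrite mulr_ge0 ?invr_ge0 ?mass_ge0.
  by rewrite ler_pM2l ?invr_gt0.
rewrite big_split /= -!mulr_sumr -mulrDr ler_pM2l ?mulr_gt0 ?invr_gt0//.
rewrite lerD2r [leRHS](bigD1 x)//= lerDl sumr_ge0// => x' _.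
exact: sumr_ge0.
Qed.

Variables (mu : X -> 'rV[R]_d -> 'rV[R]_d) (gamma : R).
Variables (PD : R -> R.-pker 'rV[R]_d ~> 'rV[R]_d) (DD : set ('rV[R]_d -> R)).
Variable LD : ('rV[R]_d -> R) -> 'rV[R]_d -> R.
Hypothesis LD_gen : is_generator rho (kernel_semigroup PD) DD LD.
Hypothesis LD_test : @test_function R d `<=` DD.

Lemma generatorZ_test (c : R) f : test_function f ->
  {ae rho, forall p, LD (fun q => c * f q) p = c * LD f p}.
Proof.
move=> tf; have [K fK] := test_function_bounded tf.
have [D1 d1] := LD_gen.2 _ (LD_test tf).
have [D2 d2] := LD_gen.2 _ (LD_test (test_functionZ c tf)).
exact: (kernel_semigroup_derivative_unique
  (test_function_measurable tf) fK D1 D2 d1 d2).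
Qed.

Variable P : R -> R.-pker (X * 'rV[R]_d)%type ~> (X * 'rV[R]_d)%type.
Variable Dhat : set (X * 'rV[R]_d -> R).
Variable Lhat : (X * 'rV[R]_d -> R) -> X * 'rV[R]_d -> R.
Hypothesis P_markov : markov_transition P.
Hypothesis P_inv : invariant_law (ppi \x rho)%E P.
Hypothesis Lhat_gen : is_generator (ppi \x rho)%E (kernel_semigroup P) Dhat Lhat.
Hypothesis Lhat_core : is_core (ppi \x rho)%E Dhat Lhat test_function_lift.
Hypothesis Lhat_formula : forall f, test_function_lift f ->
     Lhat f = lift_formula Q mu LD gamma f %[ae (ppi \x rho)%E].

Lemma generator_cst1 : Dhat (fun=> 1) /\ {ae nu, forall z, Lhat (fun=> 1) z = 0}.
Proof.
have S1 t z : kernel_semigroup P t (fun=> 1) z = 1.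
  by rewrite /kernel_semigroup Rintegral_cst// prob_kernel mulr1.
have L2cst (c : R) : L2 nu (fun=> c).
  by apply: (@bounded_L2 _ _ _ _ _ `|c|).
have d0 : semigroup_derivative nu (kernel_semigroup P) (fun=> 1) (fun=> 0).
  rewrite /semigroup_derivative.
  rewrite (_ : (fun t : R => _) = (fun=> 0%E)); first exact: cvg_cst.
  apply/funext => t; rewrite L2norm_sqrt.
    under eq_Rintegral do rewrite S1 subrr mulr0 subr0 expr0n /=.
    by rewrite Rintegral_prob_cst sqrtr0.
  under eq_fun do rewrite S1 subrr mulr0 subr0; exact: L2cst.
have D1 : Dhat (fun=> 1).
  by apply/Lhat_gen.1; split; [exact: L2cst|exists (fun=> 0)].
split=> //; have [LL dL] := Lhat_gen.2 _ D1.
have K1 (z : X * 'rV[R]_d) : `|1 : R| <= 1 by rewrite normr1.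
(* Writing [1] as [1 * 1] gives the shape of the uniqueness lemma, used with [c = 1] and derivative
   [0]. *)
have dL' : semigroup_derivative nu (kernel_semigroup P) (fun=> 1 * 1) (Lhat (fun=> 1)).
  by rewrite mulr1.
have := kernel_semigroup_derivative_unique (measurable_cst _) K1 (L2cst 0) LL d0 dL'.
by apply: filterS => z ->; rewrite mulr0.
Qed.

Lemma lift_approximation (g : X -> R) (e : R) : 0 < e ->
  exists (u w : X * 'rV[R]_d -> R) (K : R), [/\ measurable_fun setT u, forall z, `|u z| <= K,
    semigroup_derivative nu (kernel_semigroup P) u w, L2 nu w &
    \int[nu]_z `|u z - g z.1| <= e /\ \int[nu]_z `|w z - jump_part g z| <= e].
Proof.
move=> e0; pose G := \sum_x `|g x|.
have G0 : 0 <= G by exact: sumr_ge0.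
have gG x : `|g x| <= G by rewrite /G (bigD1 x)//= lerDl sumr_ge0.
have B0 : 0 <= jump_const.
  rewrite addr_ge0// sumr_ge0// => x _; last by rewrite invr_ge0 mass_ge0.
  by apply: sumr_ge0 => y _; apply: Rintegral_ge0 => p _; exact: sqr_ge0.
(* [g * Lhat chi] contributes at most [G * delta], and the jumps at most [2 * G] times the
   truncation error [2^-1 * delta * jump_const]; the [+ 1] covers [G = 0]. *)
pose C := G * (1 + jump_const) + 1.
have C0 : 0 < C by rewrite ltr_wpDl// mulr_ge0// addr_ge0.
pose delta := e / C; have delta0 : 0 < delta by rewrite divr_gt0.
have Ge : G * delta * (1 + jump_const) <= e.
  have -> : e = C * delta by rewrite /delta mulrC divfK// gt_eqF.
  by rewrite mulrAC ler_pM2r// lerDl.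
have [D1 L1] := generator_cst1.
have [chi [tchi chi1 Lchi1]] := Lhat_core.2 _ D1 _ delta0.
pose u (z : X * 'rV[R]_d) := g z.1 * chi z.
have tu : test_function_lift u.
  by move=> x; exact: (test_functionZ (g x) (tchi x)).
have [Kchi chiK] := choice (fun x => test_function_bounded (tchi x)).
pose K := \sum_x `|Kchi x|.
have chiB z : `|chi z| <= K.
  case: z => x p; rewrite (le_trans (chiK x p))// (le_trans (ler_norm _))//.
  by rewrite /K (bigD1 x)//= lerDl sumr_ge0.
have mchi x : measurable_fun setT (fun p => chi (x, p)).
  exact: test_function_measurable (tchi x).
have mchiT : measurable_fun setT chi by exact: (measurable_fun_sections X_discrete).
have mg : measurable_fun setT (fun z : X * 'rV[R]_d => g z.1).
  by apply: (measurable_fun_sections X_discrete) => x; exact: (measurable_cst (g x)).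
have mu' : measurable_fun setT u by exact: measurable_funM.
have [Lu du] := Lhat_gen.2 _ (Lhat_core.1 _ tu).
have [Lc _] := Lhat_gen.2 _ (Lhat_core.1 _ tchi).
have [L1' _] := Lhat_gen.2 _ D1.
have L2cst (c : R) (nu' : probability 'rV[R]_d R) : L2 nu' (fun=> c).
  by apply: (@bounded_L2 _ _ _ _ _ `|c|).
have chi1m : measurable_fun setT (fun z => chi z - 1) by exact: measurable_funB.
have chi1_2 := L2norm_lt_L2 chi1m chi1.
have chi1s x : L2 rho (fun p => chi (x, p) - 1).
  by apply: L2B => //; apply: (@bounded_L2 _ _ _ _ _ K) => // p.
exists u, (Lhat u), (G * K); split=> //.
  by move=> z; rewrite normrM ler_pM.
split.
  apply: (@le_trans _ _ (G * delta)).
    apply: (@le_trans _ _ (\int[nu]_z (G * `|chi z - 1|))).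
      apply: le_Rintegral => //.
      - apply/integrable_norm_EFin/L2_integrable/L2B.
          by apply: (@bounded_L2 _ _ _ _ _ (G * K)) => // z; rewrite normrM ler_pM.
        exact: (@bounded_L2 _ _ _ _ _ G).
      - exact/integrableZl_EFin/integrable_norm_EFin/L2_integrable.
      by move=> z _; rewrite /u -{2}[g z.1]mulr1 -mulrBr normrM ler_wpM2r.
    rewrite RintegralZl//; last exact/integrable_norm_EFin/L2_integrable.
    by rewrite ler_wpM2l//; exact: L2norm_lt_L1.
  have Gd0 : 0 <= G * delta by apply: mulr_ge0 => //; exact: ltW.
  by apply: le_trans Ge; rewrite ler_peMr// lerDl.
pose k (z : X * 'rV[R]_d) := \sum_y `|Q z.2 z.1 y| * `|chi (y, z.2) - 1|.
have ki x : rho.-integrable setT (EFin \o (fun p => k (x, p))).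
  apply: integrable_sum_EFin => y /=.
  under [X in EFin \o X]eq_fun do rewrite -normrM.
  exact: (integrable_norm_EFin (L2_integrableM (Q_L2 x y) (chi1s y))).
have kI : \int[nu]_z k z <= 2^-1 * delta * jump_const.
  rewrite (Rintegral_sections_ge0 X_discrete)//; last first.
    by move=> z; apply: sumr_ge0 => y _; rewrite mulr_ge0.
  apply: (@le_trans _ _ (\sum_x m x * (2^-1 * delta * jump_const))).
    apply: ler_sum => x _; apply: ler_wpM2l; first exact: mass_ge0.
    by apply: jump_truncation_error => //; exact: L2norm_lt_sqr.
  by rewrite -mulr_suml (sum_mass X_discrete) mul1r.
have kint : nu.-integrable setT (EFin \o k) by exact: (integrable_sections X_discrete).
have Lci := integrable_norm_EFin (L2_integrable Lc).
(* Since [Lhat 1 = 0] almost everywhere, approximating [1] in the graph norm makes [Lhat chi] itself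
   small. *)
have LcI : \int[nu]_z `|Lhat chi z| <= delta.
  have L2d := L2B Lc L1'.
  apply: le_trans (L2norm_lt_L1 (L2_measurable L2d) Lchi1).
  apply: Rintegral_le_ae => //; first exact/integrable_norm_EFin/L2_integrable.
  by apply: filterS L1 => z ->; rewrite subr0.
apply: (@le_trans _ _ (\int[nu]_z (G * `|Lhat chi z| + 2 * G * k z))).
  apply: Rintegral_le_ae.
  - apply/integrable_norm_EFin/L2_integrable/L2B => //; exact: jump_part_L2.
  - by apply: integrableD_EFin; exact: integrableZl_EFin.
  have LDae := ae_sections X_discrete ppi (fun x => generatorZ_test (g x) (tchi x)).
  apply: filterS3 (Lhat_formula tu) (Lhat_formula tchi) LDae => -[x p] Eu Echi /= ELD.
  (* All [mu] and [LD] terms are contained in [g x * Lhat chi]. *)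
  have -> : Lhat u (x, p) - jump_part g (x, p) = g x * Lhat chi (x, p) +
      \sum_y Q p x y * (g y - g x) * (chi (y, p) - 1).
    rewrite Eu// Echi// /lift_formula /jump_part /u /= gradZ; last by have [] := tchi x.
    rewrite dotvZr ELD.
    have -> : \sum_y Q p x y * (g y - g x) * (chi (y, p) - 1) =
        \sum_y Q p x y * (g y * chi (y, p)) - g x * \sum_y Q p x y * chi (y, p)
        - \sum_y Q p x y * (g y - g x).
      by rewrite mulr_sumr -!sumrB; apply: eq_bigr => y _; ring.
    ring.
  rewrite (le_trans (ler_normD _ _))// normrM lerD// ?ler_wpM2r//.
  rewrite (le_trans (ler_norm_sum _ _ _))// /k mulr_sumr ler_sum// => y _ /=.
  rewrite !normrM mulrCA -mulrA ler_wpM2l// ler_wpM2r//.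
  by rewrite (le_trans (ler_normB _ _))// mulr_natl mulr2n lerD.
rewrite RintegralD//; [|exact: integrableZl_EFin..].
rewrite !RintegralZl//; apply: le_trans Ge.
have -> : G * delta * (1 + jump_const) =
  G * delta + 2 * G * (2^-1 * delta * jump_const) by field.
apply: lerD; first exact: ler_wpM2l.
by apply: ler_wpM2l => //; rewrite mulr_ge0.
Qed.

Lemma lift_poincare t (g : X -> R) : 0 <= t ->
  (forall f, L20 nu f -> (L2norm nu (kernel_semigroup P t f) <=
     (expR (-1))%:E * L2norm nu f)%E) ->
  \sum_x m x * g x = 0 ->
  \sum_x m x * g x ^+ 2 <= 4 * t ^+ 2 *
    \sum_x \sum_y m x * mean_RQ rho Q x y * (g y - g x) ^+ 2.
Proof.
(* Here [a], [b], [c] stand for the squared norms of [f], [S_t f] and [S_t f - f]; since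
   [2 * b <= a / 2], half of [a] is absorbed. *)
have aux (a b c e : R) :
  a <= 2 * b + 2 * c -> b <= 4^-1 * a -> c <= e -> a <= 4 * e by lra.
move=> t0 contr g0; pose f (z : X * 'rV[R]_d) := g z.1.
pose G := \sum_x `|g x|.
have fG z : `|f z| <= G by rewrite /G (bigD1 z.1)//= lerDl sumr_ge0.
have mf : measurable_fun setT f.
  by apply: (measurable_fun_sections X_discrete) => x; exact: (measurable_cst (g x)).
have f2 : L2 nu f := bounded_L2 nu mf fG.
set S := kernel_semigroup P in contr *.
have mS : measurable_fun setT (S t f) := kernel_semigroup_measurable P t mf fG.
have SG z : `|S t f z| <= G := kernel_semigroup_bound P t z mf fG.
have S2 : L2 nu (S t f) := bounded_L2 nu mS SG.
have disp := kernel_semigroup_displacement P_markov P_inv t0 mf fG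
  (jump_part_L2 g) (lift_approximation g).
have f2E : \int[nu]_z (f z ^+ 2) = \sum_x m x * g x ^+ 2.
  exact: (Rintegral_fst X_discrete ppi rho (fun x => g x ^+ 2)).
have f20 : 0 <= \int[nu]_z (f z ^+ 2) by apply: Rintegral_ge0 => z _; exact: sqr_ge0.
have Sle : \int[nu]_z (S t f z ^+ 2) <= 4^-1 * \int[nu]_z (f z ^+ 2).
  have L20f : L20 nu f.
    by split=> //; rewrite /mean (Rintegral_fst X_discrete ppi rho g).
  have := contr f L20f; rewrite !L2norm_sqrt// -EFinM lee_fin.
  (* This follows from [e >= 1 + 1]; squaring the resulting contraction gives the factor [4^-1]. *)
  have e2 : expR (-1) <= 2^-1 :> R.
    rewrite expRN lef_pV2 ?posrE ?expR_gt0//.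
    by have := expR_ge1Dx (1 : R); rewrite -[1 + 1]/2.
  move=> le1; have le2 : Num.sqrt (\int[nu]_z (S t f z ^+ 2)) <=
      2^-1 * Num.sqrt (\int[nu]_z (f z ^+ 2)).
    by rewrite (le_trans le1)// ler_wpM2r// sqrtr_ge0.
  rewrite -[leLHS]sqr_sqrtr; last by apply: Rintegral_ge0 => z _; exact: sqr_ge0.
  rewrite -[X in _ * X](sqr_sqrtr f20).
  apply: (@le_trans _ _ ((2^-1 * Num.sqrt (\int[nu]_z (f z ^+ 2))) ^+ 2)).
    by rewrite lerXn2r// nnegrE ?mulr_ge0 ?sqrtr_ge0.
  by rewrite exprMn exprVn -natrX.
have Di : nu.-integrable setT (EFin \o (fun z => (S t f z - f z) ^+ 2)).
  exact/L2_integrable_sqr/L2B.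
have fle : \int[nu]_z (f z ^+ 2) <= 2 * \int[nu]_z (S t f z ^+ 2)
    + 2 * \int[nu]_z ((S t f z - f z) ^+ 2).
  have S2i := L2_integrable_sqr S2.
  rewrite -!RintegralZl// -RintegralD//; [|exact: integrableZl_EFin..].
  apply: le_Rintegral => //; first exact: L2_integrable_sqr.
    by apply: integrableD_EFin; exact: integrableZl_EFin.
  move=> z _; rewrite -subr_ge0.
  have -> : 2 * S t f z ^+ 2 + 2 * (S t f z - f z) ^+ 2 - f z ^+ 2 =
    (2 * S t f z - f z) ^+ 2 by ring.
  exact: sqr_ge0.
have jle := ler_wpM2l (sqr_ge0 t) (jump_part_sqr_le g).
rewrite -f2E -mulrA.
exact: aux fle Sle (le_trans disp jle).
Qed.

End lifted_process.

Theorem proposition4p5 (R : realType)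
  (* state space, laws, rates, drift *)
  (dX : measure_display) (X : finMeasurableType dX)
  (X_discrete : forall U : set X, measurable U)
  (d : nat) (d_ge1 : (1 <= d)%N)
  (ppi : probability X R) (rho : probability 'rV[R]_d R)
  (Q : 'rV[R]_d -> X -> X -> R) (mu : X -> 'rV[R]_d -> 'rV[R]_d)
  (Q_rate : forall p, rate_matrix (Q p))
  (Q_supp : forall p, vanishes_off_supp ppi (Q p))
  (Q_L2 : forall x y, L2 rho (fun p => Q p x y))
  (mu_L2 : forall x i, L2 rho (fun p => mu x p 0 i))
  (* the rho-reversible Markov semigroup on R^d and its generator *)
  (PD : R -> R.-pker 'rV[R]_d ~> 'rV[R]_d)
  (DD : set ('rV[R]_d -> R)) (LD : ('rV[R]_d -> R) -> 'rV[R]_d -> R)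
  (PD_markov : markov_transition PD)
  (PD_rev : reversible_law rho PD)
  (PD_cont : strongly_continuous rho (kernel_semigroup PD))
  (LD_gen : is_generator rho (kernel_semigroup PD) DD LD)
  (LD_test : @test_function R d `<=` DD)
  (gamma : R) (gamma_ge0 : 0 <= gamma)
  (* the process Z, its invariance and its generator *)
  (P : R -> R.-pker (X * 'rV[R]_d)%type ~> (X * 'rV[R]_d)%type)
  (Dhat : set (X * 'rV[R]_d -> R))
  (Lhat : (X * 'rV[R]_d -> R) -> X * 'rV[R]_d -> R)
  (P_markov : markov_transition P)
  (P_inv : invariant_law (ppi \x rho)%E P)
  (P_cont : strongly_continuous (ppi \x rho)%E (kernel_semigroup P))
  (Lhat_gen : is_generator (ppi \x rho)%E (kernel_semigroup P) Dhat Lhat)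
  (Lhat_core : is_core (ppi \x rho)%E Dhat Lhat test_function_lift)
  (Lhat_formula : forall f, test_function_lift f ->
     Lhat f = lift_formula Q mu LD gamma f %[ae (ppi \x rho)%E])
  (mu_inv : forall x, mass ppi x != 0 -> forall f, test_function f ->
     \int[rho]_p dotv (grad f p) (mu x p)
     = - \int[rho]_p (f p * qrate ppi Q p x))
  (* the reversible part *)
  (Drev : set (X * 'rV[R]_d -> R))
  (Lrev : (X * 'rV[R]_d -> R) -> X * 'rV[R]_d -> R)
  (F : set (X * 'rV[R]_d -> R))
  (E : (X * 'rV[R]_d -> R) -> (X * 'rV[R]_d -> R) -> R)
  (E_form : closed_symmetric_dirichlet_form (ppi \x rho)%E F E)
  (Lrev_form : is_form_operator (ppi \x rho)%E F E Drev Lrev)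
  (Lrev_core : is_core (ppi \x rho)%E Drev Lrev test_function_lift)
  (Lrev_formula : forall f, test_function_lift f ->
     Lrev f = rev_formula ppi Q LD gamma f %[ae (ppi \x rho)%E])
  (Dhat_Drev : Dhat `<=` Drev)
  (Lhat_Lrev : forall f, Dhat f ->
     L2dot (ppi \x rho)%E f (Lhat f) = L2dot (ppi \x rho)%E f (Lrev f))
  (gap_gt0 : (0 < spectral_gap (ppi \x rho)%E Drev Lrev)%E) :
  (((2 * Num.sqrt 2)^-1)%:E
     * sqrte (relaxation_time ppi (exp_semigroup (mean_RQrev ppi rho Q)))
   <= relaxation_time (ppi \x rho) (kernel_semigroup P))%E
  /\
  (forall (leb : {measure set 'rV[R]_d -> \bar R})
     (r : 'rV[R]_d -> R) (gr : 'rV[R]_d -> 'rV[R]_d)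
     (Qbar : X -> X -> R) (sigma : X -> X -> 'rV[R]_d),
   let score p := (r p)^-1 *: gr p in
   is_lebesgue leb -> is_density leb rho r -> (forall p, 0 < r p) ->
   is_weak_grad leb r gr ->
   (forall i, L2 rho (fun p => score p 0 i)) ->
   rate_matrix Qbar -> vanishes_off_supp ppi Qbar ->
   (forall x y, mass ppi x * Qbar x y = mass ppi y * Qbar y x) ->
   (forall x y, 0 < Qbar x y ->
      sigma x y = - sigma y x /\ enorm (sigma x y) = 1) ->
   (forall p x y, x != y ->
      Q p x y = if 0 < Qbar x y
                then Qbar x y * Num.max 0 (- dotv (sigma x y) (score p))
                else 0) ->
   (((2 * Num.sqrt (2 * max_rate Qbar
                      * \int[rho]_p (enorm (score p) ^+ 2)))^-1)%:E
      * sqrte (relaxation_time ppi (exp_semigroup Qbar))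
    <= relaxation_time (ppi \x rho) (kernel_semigroup P))%E).
Proof.
(* This is kept with the unsymmetrized rates because the two bounds part here: the first symmetrizes
   them, the second dominates them by multiples of [Qbar]. *)
have poinc t : 0 <= t ->
    (forall f, L20 (ppi \x rho)%E f ->
      (L2norm (ppi \x rho) (kernel_semigroup P t f) <=
       (expR (-1))%:E * L2norm (ppi \x rho) f)%E) ->
    forall g, \sum_x mass ppi x * g x = 0 ->
    \sum_x mass ppi x * g x ^+ 2 <= 4 * t ^+ 2 *
      \sum_x \sum_y mass ppi x * mean_RQ rho Q x y * (g y - g x) ^+ 2.
  move=> t0 contr g g0.
  exact: (lift_poincare X_discrete Q_rate Q_supp Q_L2 LD_gen LD_test P_markov
    P_inv Lhat_gen Lhat_core Lhat_formula t0 contr g0).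
split.
  apply: le_ereal_inf_tmp => _ [t [t0 contr] <-].
  rewrite -[X in Num.sqrt X]mulr1; apply: sqrte_relaxation_le => //.
  rewrite mulr1; apply: (relaxation_time_poincare X_discrete).
  - exact: mean_RQrev_row.
  - exact: mean_RQrev_sym.
  - move=> g g0; apply: (le_trans (poinc t t0 contr g g0)).
    rewrite (dirichlet_mean_RQrev Q_rate Q_supp Q_L2) mulrA.
    by rewrite (_ : 4 * t ^+ 2 * 2 = 8 * t ^+ 2)//; ring.
  - by rewrite mulr_ge0 ?sqr_ge0.
move=> leb r gr Qbar sigma score _ _ _ _ score2 Qbar_rate Qbar_supp Qbar_rev
  sigma1 QE.
apply: le_ereal_inf_tmp => _ [t [t0 contr] <-].
have enorm2E p : enorm (score p) ^+ 2 = \sum_i score p 0 i ^+ 2.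
  rewrite sqr_sqrtr; first by apply: eq_bigr => i _; rewrite expr2.
  by apply: sumr_ge0 => i _; rewrite -expr2 sqr_ge0.
have enorm2i : rho.-integrable setT (EFin \o (fun p => enorm (score p) ^+ 2)).
  under [X in EFin \o X]eq_fun do rewrite enorm2E.
  by apply: integrable_sum_EFin => i; exact: L2_integrable_sqr.
have Qbar0 x y : x != y -> 0 <= Qbar x y by exact: Qbar_rate.1.
have Qle p x y : x != y -> Q p x y <= Qbar x y * enorm (score p).
  move=> xy; rewrite QE//; case: ifPn => [Q0|_]; last first.
    by rewrite mulr_ge0 ?sqrtr_ge0 ?Qbar0.
  have [_ s1] := sigma1 _ _ Q0.
  rewrite ler_pM2l// ge_max sqrtr_ge0 /=.
  have := dotv_unit_le_enorm (score p) s1.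
  by apply: le_trans; rewrite -normrN ler_norm.
have Rle p : max_rate (Q p) <= max_rate Qbar * enorm (score p).
  apply: bigmax_le; first by rewrite mulr_ge0 ?max_rate_ge0 ?sqrtr_ge0.
  move=> x _; apply: (@le_trans _ _ ((\sum_(y | y != x) Qbar x y) * enorm (score p))).
    by rewrite mulr_suml; apply: ler_sum => y yx; apply: Qle; rewrite eq_sym.
  by rewrite ler_wpM2r ?sqrtr_ge0// le_max_rate.
set I2 := \int[rho]_p _.
have I20 : 0 <= I2 by apply: Rintegral_ge0 => p _; exact: sqr_ge0.
have k0 : 0 <= max_rate Qbar * I2 by rewrite mulr_ge0 ?max_rate_ge0.
(* The maximal rate and the single rate are each at most linear in the norm of the score, so their
   product brings in the square whose mean is [I2]. *)
have qle x y : x != y -> mean_RQ rho Q x y <= max_rate Qbar * I2 * Qbar x y.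
  move=> xy; rewrite mulrAC /mean_RQ -RintegralZl//.
  apply: le_Rintegral => //.
  - exact: max_rateM_integrable.
  - exact: integrableZl_EFin.
  move=> p _; apply: (@le_trans _ _ ((max_rate Qbar * enorm (score p))
      * (Qbar x y * enorm (score p)))).
    by apply: ler_pM; rewrite ?max_rate_ge0 ?Qle//; apply: (Q_rate p).1.
  by rewrite expr2 mulrACA.
rewrite -[2 * max_rate Qbar * I2]mulrA; apply: sqrte_relaxation_le => //.
apply: (relaxation_time_poincare X_discrete) => //.
- by move=> x; exact: rate_matrix_row.
- move=> g g0; apply: (le_trans (poinc t t0 contr g g0)).
  rewrite /dirichlet.
  have -> : 8 * t ^+ 2 * (max_rate Qbar * I2) * (2^-1 *
      \sum_x \sum_y mass ppi x * Qbar x y * (g y - g x) ^+ 2) =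
      4 * t ^+ 2 * (max_rate Qbar * I2 *
      \sum_x \sum_y mass ppi x * Qbar x y * (g y - g x) ^+ 2) by field.
  apply: ler_wpM2l; first by rewrite mulr_ge0 ?sqr_ge0.
  rewrite mulr_sumr; apply: ler_sum => x _; rewrite mulr_sumr.
  apply: ler_sum => y _.
  (* The rates are compared off the diagonal only; on it the increment of [g] is zero. *)
  have [->|xy] := eqVneq x y; first by rewrite subrr expr0n /= !mulr0.
  rewrite mulrA ler_wpM2r ?sqr_ge0// mulrCA ler_wpM2l ?mass_ge0//.
  exact: qle.
- by rewrite mulr_ge0// mulr_ge0 ?sqr_ge0.
Qed.
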